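(* Let $d\ge3$, $\theta\in(0,1)$ and $M>0$. There exists a constant $c_1(\theta,M)>0$ (depending only on $\theta$, $M$ and $d$) such that for every $\mathcal{G}\in\{\mathbb{Z}^d\}\cup\{\mathbb{T}_L: L\ge1\}$, every finite non-empty $K\subset\mathcal{G}$, every increasing $A\subset\{0,1\}^K$, every $x\in K$ and every $h\in(-M,M)$, $$\mathbb{E}_\theta^{\mathcal{G}}[1_{A^h}(\varphi)\cdot\kappa_x^{\mathrm{tr}}\varphi_x]\;\ge\; c_1(\theta,M)\cdot I_\theta^{\mathcal{G}}(A^h,x),$$ and $$-\frac{d\,\mathbb{P}_\theta^{\mathcal{G}}[A^h]}{dh}\;\ge\; c_1(\theta,M)\cdot\sum_{y\in K}I_\theta^{\mathcal{G}}(A^h,y).$$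
   Context: $\mathbb{T}_L=(\mathbb{Z}/2L\mathbb{Z})^d$, for integers $L\ge1$; $\mathcal{G}$ stands for $\mathbb{Z}^d$ or some $\mathbb{T}_L$, with the nearest-neighbor graph structure. For $\theta\in(0,1)$, $P_\theta^x$ is the law of the Markov chain $(X_n)_{n\ge0}$ on $\mathcal{G}\cup\{\Delta\}$ started at $x\in\mathcal{G}$, where $\Delta$ is an absorbing cemetery state: from $y\in\mathcal{G}$ the chain jumps to $\Delta$ with probability $\theta$, and with probability $1-\theta$ it makes a simple random walk step on $\mathcal{G}$, i.e. moves to $y\pm e_i$, each of these $2d$ choices ($1\le i\le d$, sign $\pm$) having probability $\frac{1-\theta}{2d}$. The Green function is $g_\theta(x,y)=\sum_{n\ge0}P_\theta^x[X_n=y]$. $\mathbb{P}_\theta^{\mathcal{G}}$ (expectation $\mathbb{E}_\theta^{\mathcal{G}}$) is the law on $\mathbb{R}^{\mathcal{G}}$ under which the canonical coordinates $\varphi=(\varphi_x)_{x\in\mathcal{G}}$ form a centered Gaussian field with covariance $g_\theta(\cdot,\cdot)$. For finite $K\subset\mathcal{G}$, $A\subset\{0,1\}^K$ and $h\in\mathbb{R}$, $A^h=\{(1\{\varphi_x\ge h\})_{x\in K}\in A\}$. $A$ is increasing if $\omega\in A$ and $\omega\le\omega'$ coordinatewise imply $\omega'\in A$. With $\widetilde H_K=\inf\{n\ge1:X_n\in K\}$, $\kappa_x^{\mathrm{tr}}=P_\theta^x[\widetilde H_K=\infty]$ for $x\in K$. The conditional influence of $x\in K$ on $A^h$ is $$I_\theta^{\mathcal{G}}(A^h,x)=\mathbb{P}_\theta^{\mathcal{G}}[A^h\mid\varphi_x\ge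 h]-\mathbb{P}_\theta^{\mathcal{G}}[A^h\mid\varphi_x<h].$$ *)

(* Defs.v *)
From HB Require Import structures.
From mathcomp Require Import all_boot all_order all_algebra finmap.
From mathcomp Require Import all_classical all_reals all_analysis.

Set Implicit Arguments.
Unset Strict Implicit.
Unset Printing Implicit Defensive.

Import Order.TTheory GRing.Theory Num.Theory.
Import numFieldNormedType.Exports.

Local Open Scope classical_set_scope.
Local Open Scope ring_scope.

Inductive graph : Type :=
| Lattice
| Torus (L : nat) of (0 < L)%N.

(* ['Z_n] is Z/nZ only for [n >= 2], which holds here since [0 < L]. *)
Definition coordinate_ring (G : graph) : comNzRingType :=
  match G with
  | Lattice => int
  | Torus L _ => 'Z_(2 * L)%N
  end.

Definition vertex (d : nat) (G : graph) : zmodType := {ffun 'I_d -> coordinate_ring G}.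

Definition unit_vec (d : nat) (G : graph) (i : 'I_d) : vertex d G :=
  [ffun j => (j == i)%:R].

Section KilledWalk.
Variables (R : realType) (d : nat) (G : graph) (theta : R).
Local Notation V := (vertex d G).

(* [None] is the cemetery state.  The sum runs over the [2 * d] choices of a
   signed direction rather than over the neighbours of [y], since in the torus
   with [L = 1] the vertices [y + e_i] and [y - e_i] coincide. *)
Definition trans (u v : option V) : R :=
  match u, v with
  | None, None => 1
  | None, Some _ => 0
  | Some _, None => theta
  | Some y, Some z =>
      \sum_(i < d) ((y + unit_vec G i == z)%:R + (y - unit_vec G i == z)%:R)
        * ((1 - theta) / (2 * d)%N%:R)
  end.

(* The product sigma-algebra on trajectories: the state space being countable,
   it is generated by the events [X_n = u]. *)
Definition path_events : set (set (nat -> option V)) :=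
  [set E | exists n u, E = [set X | X n = u]].
Definition path_space := g_sigma_algebraType path_events.

Definition killed_walk_law (x : V) (Px : probability path_space R) : Prop :=
  forall (n : nat) (w : nat -> option V),
    Px [set X | forall k, (k <= n)%N -> X k = w k] =
    ((w 0%N == Some x)%:R * \prod_(k < n) trans (w k) (w k.+1))%:E.

Variable Pwalk : V -> probability path_space R.

Definition green (x y : V) : \bar R :=
  (\sum_(0 <= n <oo) Pwalk x [set X | X n = Some y])%E.

Definition hitting_time (K : {fset V}) (X : nat -> option V) : \bar R :=
  ereal_inf [set n%:R%:E | n in
    [set n | (1 <= n)%N /\ exists2 y, y \in K & X n = Some y]].

Definition kappa_tr (K : {fset V}) (x : V) : R :=
  fine (Pwalk x [set X | hitting_time K X = +oo%E]).

End KilledWalk.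

Section GaussianField.
Variables (R : realType) (T : choiceType).

Definition field_events : set (set (T -> R)) :=
  [set E | exists x (B : set R), measurable B /\ E = [set phi | B (phi x)]].
Definition field_space := g_sigma_algebraType field_events.

(* The library's [normal_prob m s] is the normal law only for [s != 0]. *)
Definition gaussian_law (mu : set R -> \bar R) : Prop :=
  exists m s : R, 0 <= s /\ forall B : set R, measurable B ->
    mu B = if s == 0 then \d_m B else normal_prob m s B.

Variable P : probability field_space R.

Definition centered_gaussian_field (g : T -> T -> \bar R) : Prop :=
  [/\ forall (s : seq T) (a : T -> R),
        gaussian_law (pushforward P (fun phi => \sum_(x <- s) a x * phi x)),
      forall x, ('E_P[fun phi => phi x] = 0)%E
    & forall x y, covariance P (fun phi => phi x) (fun phi => phi y) = g x y].

Variable K : {fset T}.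

Definition increasing (A : {set {ffun K -> bool}}) : Prop :=
  forall w w' : {ffun K -> bool},
    w \in A -> (forall z, w z -> w' z) -> w' \in A.

Definition excursion_event (A : {set {ffun K -> bool}}) (h : R)
  : set field_space :=
  [set phi | [ffun z : K => h <= phi (val z)] \in A].

Definition excursion_prob (A : {set {ffun K -> bool}}) (h : R) : R :=
  fine (P (excursion_event A h)).

Definition cond_prob (E F : set field_space) : R :=
  fine (P (E `&` F)) / fine (P F).

Definition influence (A : {set {ffun K -> bool}}) (h : R) (x : T) : R :=
  cond_prob (excursion_event A h) [set phi | h <= phi x]
  - cond_prob (excursion_event A h) [set phi | phi x < h].

End GaussianField.

(* Main.v *)
(* Given [phi x = sqrt (g x x) * t], the conditional probability [f t] of the
   increasing event is a nondecreasing function of [t], because [g x y >= 0].  Both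
   sides of the first inequality are then integrals of [f] against the standard
   normal law, and they are compared by a one-dimensional argument; the constant is
   uniform because [g x x >= 1] and [kappa_x >= theta].

   For the second inequality, let [Z = \sum_(y in K) kappa_y phi_y].  Decomposing the
   walk at its last visit to [K] gives [\sum_(y in K) g x y kappa_y = 1] for [x] in
   [K], so [Z] has the same covariance with every coordinate in [K], and lowering the
   level [h] amounts to shifting [Z].  Gaussian integration by parts in the direction
   [Z] yields [- d P(A^h) / dh = E (1_(A^h) Z)], the sum over [y] of the left-hand
   sides of the first inequality.

   Both arguments split the field into a linear form and an independent remainder.
   As only the one-dimensional laws of linear forms are given, this independence is
   derived from uniqueness of Fourier transforms. *)
Require Import Defs.
From HB Require Import structures.
From mathcomp Require Import all_boot all_order all_algebra finmap ring lra.
From mathcomp Require Import all_classical all_reals all_analysis measurable_realfun.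

Set Implicit Arguments.
Unset Strict Implicit.
Unset Printing Implicit Defensive.

Import Order.TTheory GRing.Theory Num.Theory.
Import numFieldNormedType.Exports.

Local Open Scope classical_set_scope.
Local Open Scope ring_scope.

(** No conditioning is ever performed. Adding [b y * t], with [t] an independent standard normal, to
    the remainder [w y - b y * N w] gives a model of the field on [gauss \x P], and [f t] is an
    integral over [w], defined and monotone for every [t]. What has to be proved is that the
    excursion event and [N] have the same joint law as in the model. Two facts keep this elementary.
    Cosines with a free phase, [cos (t * X + u)], replace complex characteristic functions, and
    products of cosines are sums of cosines, so every comparison reduces to the variance of one
    linear form. And the event sees the field only through indicators of half-lines, so uniqueness
    is needed for finite products of these rather than for general Borel sets. The constant is
    [theta * c0]. Dividing [phi x] by its standard deviation [sigma >= 1] keeps the threshold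
    [h / sigma] between [- M] and [M] and puts a factor [sigma] on the larger side, so [c0] depends
    on [M] alone. Nonnegativity of the expectation then lets [sigma] and [kappa_x] be replaced by
    their lower bounds. *)

Section IntegrationLemmas.
Context {R : realType}.

Lemma bounded_integrable d (T : measurableType d)
    (m : {finite_measure set T -> \bar R}) (f : T -> R) (C : R) :
  measurable_fun setT f -> (forall x, `|f x| <= C) ->
  m.-integrable setT (EFin \o f).
Proof.
move=> mf fC; apply: measurable_bounded_integrable => //.
  by rewrite -ge0_fin_numE// fin_num_measure.
exists C; split; first exact: num_real.
by move=> M CM x _ /=; apply: le_trans (fC x) (ltW CM).
Qed.

Lemma Rintegral_probability_cst d (T : measurableType d) (P : probability T R)
  (c : R) : \int[P]_x c = c.
Proof.
rewrite Rintegral_cst// -[RHS]mulr1; congr (_ * _).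
exact: (congr1 fine (probability_setT P)).
Qed.

Lemma Rintegral_fubini d1 d2 (T1 : measurableType d1) (T2 : measurableType d2)
    (m1 : {sigma_finite_measure set T1 -> \bar R})
    (m2 : {sigma_finite_measure set T2 -> \bar R}) (f : T1 * T2 -> R) :
  (m1 \x m2)%E.-integrable setT (EFin \o f) ->
  (forall x, m2.-integrable setT (fun y => (f (x, y))%:E)) ->
  (forall y, m1.-integrable setT (fun x => (f (x, y))%:E)) ->
  \int[m1]_x \int[m2]_y f (x, y) = \int[m2]_y \int[m1]_x f (x, y).
Proof.
move=> fi f1 f2; rewrite /Rintegral.
under eq_integral do rewrite fineK ?integrable_fin_num//.
under [in RHS]eq_integral do rewrite fineK ?integrable_fin_num//.
by rewrite (Fubini fi).
Qed.

Lemma Rintegral_prod d1 d2 (T1 : measurableType d1) (T2 : measurableType d2)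
    (m1 : {sigma_finite_measure set T1 -> \bar R})
    (m2 : {sigma_finite_measure set T2 -> \bar R}) (f : T1 * T2 -> R) :
  (m1 \x m2)%E.-integrable setT (EFin \o f) ->
  (forall x, m2.-integrable setT (fun y => (f (x, y))%:E)) ->
  \int[(m1 \x m2)%E]_z f z = \int[m1]_x \int[m2]_y f (x, y).
Proof.
move=> fi f1; rewrite /Rintegral.
under [in RHS]eq_integral do rewrite fineK ?integrable_fin_num//.
by rewrite (integral12_prod_meas1 fi).
Qed.

(** Dominated differentiation in the form that trigonometric integrands need: the derivatives of
    [cos (u * x)] and [sin (u * x)] in [u] are bounded by [|x|] for all [u] at once. *)
Lemma is_derive_Rintegral d (T : measurableType d) (m : {measure set T -> \bar R})
    (G : T -> R) (f df : R -> T -> R) (t : R) :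
  m.-integrable setT (EFin \o G) ->
  (forall u, m.-integrable setT (fun x => (f u x)%:E)) ->
  (forall (u : R) x, is_derive u 1 (f ^~ x) (df u x)) ->
  (forall u x, `|df u x| <= G x) ->
  is_derive t 1 (fun u => \int[m]_x f u x) (\int[m]_x df t x).
Proof.
move=> iG fi fd dfb.
have pd (u : R) x : partial1of2 f u x = df u x.
  by rewrite partial1of2E; exact: (@derive_val _ _ _ _ _ _ _ (fd u x)).
have I0 : `]t - 1, t + 1[%classic t.
  by rewrite /= in_itv/=; apply/andP; split; lra.
have H1 (u : R) : `]t - 1, t + 1[%classic u -> m.-integrable setT (EFin \o f u).
  by move=> _; exact: fi.
have H2 (u : R) x : `]t - 1, t + 1[%classic u -> setT x -> derivable (f ^~ x) u 1.
  by move=> _ _; exact: ex_derive.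
have H3 x : 0 <= G x := le_trans (normr_ge0 _) (dfb t x).
have H4 (u : R) x : `]t - 1, t + 1[%classic u -> setT x ->
    `|partial1of2 f u x| <= G x.
  by move=> _ _; rewrite pd.
have D1 := derivable_under_integral measurableT I0 H1 H2 H3 iG H4.
have D2 := differentiation_under_integral measurableT I0 H1 H2 H3 iG H4.
apply: DeriveDef => //.
by rewrite -derive1E D2; apply: eq_Rintegral => x _; rewrite pd.
Qed.

(** Lebesgue measure is characterised by its values on the intervals []u, v]], and [s] times its
    image under [x |-> a + s * x] has the same values there. *)
Lemma integral_lebesgue_affine (a s : R) (f : R -> R) : 0 < s ->
  measurable_fun setT f -> (forall x, 0 <= f x) ->
  (\int[lebesgue_measure]_x (f x)%:E =
   s%:E * \int[lebesgue_measure]_x (f (a + s * x)%R)%:E)%E.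
Proof.
move=> s0 mf f0.
pose phi (x : R) : measurableTypeR R := a + s * x.
have mphi : measurable_fun setT phi.
  by apply: measurable_funD => //; exact: measurable_funM.
pose pm : {measure set (measurableTypeR R) -> \bar R} :=
  pushforward (@lebesgue_measure R) phi.
pose sm := mscale (NngNum (ltW s0)) (pm mphi).
have E : forall A, measurable A -> lebesgue_measure A = sm A.
  apply: lebesgue_measure_unique => _ [[u v] _ <-].
  transitivity (s%:E * lebesgue_measure (phi @^-1` `]u, v]%classic))%E; last by [].
  have -> : phi @^-1` `]u, v]%classic = `](u - a) / s, (v - a) / s]%classic.
    apply/seteqP; split => x /=; rewrite !in_itv/= /phi => /andP[h1 h2].
      by apply/andP; split; rewrite ?ltr_pdivrMr ?ler_pdivlMr//; lra.
    move: h1 h2; rewrite ltr_pdivrMr ?ler_pdivlMr// => h1 h2.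
    by apply/andP; split; lra.
  rewrite !lebesgue_measure_itv/= !lte_fin ltr_pM2r ?invr_gt0//.
  rewrite ltrD2r; case: ifPn => uv; last by rewrite mule0.
  by rewrite -!EFinB -EFinM; congr EFin; field; rewrite gt_eqF.
have -> : (\int[lebesgue_measure]_x (f x)%:E = \int[sm]_x (f x)%:E)%E.
  by apply: eq_measure_integral => A mA _; exact: E.
have mfE : measurable_fun setT (EFin \o f) by exact/measurable_EFinP.
rewrite ge0_integral_mscale//; last by move=> x _; rewrite lee_fin.
by congr (_ * _)%E; rewrite ge0_integral_pushforward// => x _; rewrite lee_fin.
Qed.

Lemma integrable_lebesgue_shift (a : R) (f : R -> R) :
  measurable_fun setT f -> lebesgue_measure.-integrable setT (EFin \o f) ->
  lebesgue_measure.-integrable setT (fun x => (f (a + x))%:E).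
Proof.
move=> mf /integrableP[_ fi]; apply/integrableP; split.
  by apply/measurable_EFinP; apply: measurableT_comp => //; exact: measurable_funD.
apply: le_lt_trans fi.
rewrite /= (@integral_lebesgue_affine a 1 (fun x => `|f x|))//; last first.
  exact: measurableT_comp.
by rewrite mul1e le_eqVlt; apply/orP; left; apply/eqP;
  apply: eq_integral => x _; rewrite mul1r.
Qed.

Lemma Rintegral_lebesgue_shift (a : R) (f : R -> R) :
  measurable_fun setT f -> lebesgue_measure.-integrable setT (EFin \o f) ->
  \int[lebesgue_measure]_x f (a + x) = \int[lebesgue_measure]_x f x.
Proof.
move=> mf fi.
(* The change of variables is proved for nonnegative functions, so [f] is written as [g - |f|], both
   terms being nonnegative. *)
pose g x := f x + `|f x|.
have mn : measurable_fun setT (fun x => `|f x|) by exact: measurableT_comp.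
have ni : lebesgue_measure.-integrable setT (EFin \o (fun x => `|f x|)).
  exact: (integrable_norm fi).
have mg : measurable_fun setT g by exact: measurable_funD.
have gi : lebesgue_measure.-integrable setT (EFin \o g).
  rewrite (_ : EFin \o g = (EFin \o f) \+ (EFin \o (fun x => `|f x|%R)))%E//.
  exact: integrableD.
have g0 x : 0 <= g x by rewrite /g; have := ler_norm (- f x); rewrite normrN; lra.
have shift (k : R -> R) : measurable_fun setT k -> (forall x, 0 <= k x) ->
    \int[lebesgue_measure]_x k (a + x) = \int[lebesgue_measure]_x k x.
  move=> mk k0; rewrite /Rintegral (@integral_lebesgue_affine a 1 k)// mul1e.
  by congr fine; apply: eq_integral => x _; rewrite mul1r.
have fE : f = (fun x => g x - `|f x|) by apply/funext=> x; rewrite /g; lra.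
rewrite [in LHS]fE [in RHS]fE !RintegralB//; last 2 first.
- exact: integrable_lebesgue_shift.
- exact: (@integrable_lebesgue_shift _ (fun x => `|f x|)).
by rewrite shift// (shift (fun x => `|f x|)).
Qed.

End IntegrationLemmas.

(** * Integration against normal densities, and Gaussian integration by parts *)

Section StandardNormal.
Context {R : realType}.
Local Notation leb := (@lebesgue_measure R).
Local Notation gauss := (normal_prob (0 : R) 1).

(** [normal_prob] is defined by integrating [normal_pdf] over sets. The density thus has the same
    integral as the Radon-Nikodym derivative on every measurable set, so the two agree almost
    everywhere and the change of variables for the latter applies. *)
Lemma ge0_integral_normal (m s : R) (f : R -> R) :
  measurable_fun setT f -> (forall x, 0 <= f x) ->
  (\int[normal_prob m s]_x (f x)%:E =
   \int[leb]_x (f x * normal_pdf m s x)%:E)%E.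
Proof.
move=> mf f0.
have mfE : measurable_fun setT (EFin \o f) by exact/measurable_EFinP.
have mpE : measurable_fun setT (EFin \o normal_pdf m s).
  by apply/measurable_EFinP; exact: measurable_normal_pdf.
rewrite -(Radon_Nikodym_SigmaFinite.change_of_variables
  (normal_prob_dominates m s))//.
under [in RHS]eq_integral do rewrite EFinM.
apply: ae_eq_integral => //.
- apply: emeasurable_funM => //.
  apply: (measurable_int leb); apply: Radon_Nikodym_SigmaFinite.f_integrable.
  exact: normal_prob_dominates.
- exact: emeasurable_funM.
- apply: ae_eqe_mul2l.
  apply: integral_ae_eq => //.
    apply: Radon_Nikodym_SigmaFinite.f_integrable.
    exact: normal_prob_dominates.
  move=> E _ mE; rewrite -Radon_Nikodym_SigmaFinite.f_integral//.
  exact: normal_prob_dominates.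
Qed.

Lemma integrable_normal (m s : R) (f : R -> R) : measurable_fun setT f ->
  leb.-integrable setT (fun x => (f x * normal_pdf m s x)%:E) ->
  (normal_prob m s).-integrable setT (EFin \o f).
Proof.
move=> mf /integrableP[_ fi]; apply/integrableP; split.
  exact/measurable_EFinP.
rewrite /= (@ge0_integral_normal m s (fun x => `|f x|))//; last first.
  exact: measurableT_comp.
apply: le_lt_trans fi; apply: ge0_le_integral => //=.
- by move=> x _; rewrite lee_fin mulr_ge0// normal_pdf_ge0.
- apply/measurable_EFinP/measurable_funM; first exact: measurableT_comp.
  exact: measurable_normal_pdf.
- apply/measurable_EFinP/measurableT_comp => //; apply/measurable_funM => //.
  exact: measurable_normal_pdf.
- move=> x _; rewrite lee_fin normrM ler_wpM2l//.
  exact: ler_norm.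
Qed.

Lemma integrable_normalP (m s : R) (f : R -> R) : measurable_fun setT f ->
  (normal_prob m s).-integrable setT (EFin \o f) ->
  leb.-integrable setT (fun x => (f x * normal_pdf m s x)%:E).
Proof.
move=> mf /integrableP[_ fi]; apply/integrableP; split.
  by apply/measurable_EFinP/measurable_funM => //; exact: measurable_normal_pdf.
rewrite /= (@ge0_integral_normal m s (fun x => `|f x|)) in fi; last 2 first.
  exact: measurableT_comp.
  by [].
apply: le_lt_trans fi; apply: ge0_le_integral => //=.
- apply/measurable_EFinP/measurableT_comp => //; apply/measurable_funM => //.
  exact: measurable_normal_pdf.
- apply/measurable_EFinP/measurable_funM; first exact: measurableT_comp.
  exact: measurable_normal_pdf.
- by move=> x _; rewrite lee_fin normrM (ger0_norm (normal_pdf_ge0 _ _ _)).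
Qed.

Lemma Rintegral_normal (m s : R) (f : R -> R) : measurable_fun setT f ->
  (normal_prob m s).-integrable setT (EFin \o f) ->
  \int[normal_prob m s]_x f x = \int[leb]_x (f x * normal_pdf m s x).
Proof.
move=> mf fi; have fi' := integrable_normalP mf fi.
have fE : f = (fun x => (f x + `|f x|) - `|f x|) by apply/funext=> x; lra.
have mn : measurable_fun setT (fun x => `|f x|) by exact: measurableT_comp.
have ni : (normal_prob m s).-integrable setT (fun x => `|f x|%:E).
  exact: (integrable_norm fi).
have md : measurable_fun setT (fun x => f x + `|f x|) by exact: measurable_funD.
have di : (normal_prob m s).-integrable setT (fun x => (f x + `|f x|)%:E).
  under eq_fun do rewrite EFinD.
  exact: integrableD.
rewrite [in LHS]fE RintegralB//.
under [RHS]eq_Rintegral => x _.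
  rewrite (_ : f x * _ = (f x + `|f x|) * normal_pdf m s x - `|f x| * normal_pdf m s x);
    last by ring.
  over.
rewrite RintegralB//; last 2 first.
- exact: (integrable_normalP md di).
- exact: (integrable_normalP mn ni).
rewrite /Rintegral; congr (fine _ - fine _); rewrite ge0_integral_normal//.
by move=> x; have := ler_norm (- f x); rewrite normrN; lra.
Qed.

Lemma normal_pdf01E (x : R) :
  normal_pdf 0 1 x = normal_peak 1 * expR (- (x ^+ 2 / 2)).
Proof.
rewrite normal_pdfE ?oner_neq0// /normal_fun subr0 expr1n.
by congr (_ * expR _); rewrite mulNr.
Qed.

(** The bound is, up to a constant, the density of the normal law of variance [2]. It decays more
    slowly than the standard density, which leaves room to absorb exponential growth of an
    integrand. *)
Lemma integrable_subgaussian (g : R -> R) (C : R) : measurable_fun setT g ->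
  (forall x, `|g x| <= C * expR (- (x ^+ 2 / 4))) ->
  leb.-integrable setT (EFin \o g).
Proof.
move=> mg gC.
have s0 : Num.sqrt (2 : R) != 0 by rewrite gt_eqF// sqrtr_gt0.
have p0 := normal_peak_gt0 s0.
have C0 : 0 <= C.
  by have := le_trans (normr_ge0 _) (gC 0); rewrite pmulr_lge0// expR_gt0.
have pE x : C * expR (- (x ^+ 2 / 4)) =
    C / normal_peak (Num.sqrt 2) * normal_pdf 0 (Num.sqrt 2) x.
  rewrite normal_pdfE// /normal_fun subr0 sqr_sqrtr// mulrA divfK ?gt_eqF//.
  by congr (_ * expR _); field.
apply: (@le_integrable _ _ _ leb _ _ _
  (fun x => (C / normal_peak (Num.sqrt 2) * normal_pdf 0 (Num.sqrt 2) x)%:E)) => //.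
- exact/measurable_EFinP.
- move=> x _; rewrite lee_fin -pE (le_trans (gC x))// ler_norm//.
- under eq_fun do rewrite EFinM; apply: integrableZl => //.
  exact: integrable_normal_pdf.
Qed.

Lemma integrable_gauss_exp (F : R -> R) (C k : R) : measurable_fun setT F ->
  (forall x, `|F x| <= C * expR (k * `|x|)) -> gauss.-integrable setT (EFin \o F).
Proof.
move=> mF FC; apply: integrable_normal => //.
(* The factor [expR (k ^+ 2)] comes from completing the square: [k * |x| - x ^+ 2 / 2 <= k ^+ 2 - x
   ^+ 2 / 4]. *)
apply: (@integrable_subgaussian _ (C * normal_peak 1 * expR (k ^+ 2))).
  by apply: measurable_funM => //; exact: measurable_normal_pdf.
move=> x; rewrite normrM normal_pdf01E (ger0_norm (mulr_ge0 _ _)) ?expR_ge0 ?normal_peak_ge0//.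
have C0 : 0 <= C.
  by have := le_trans (normr_ge0 _) (FC 0); rewrite pmulr_lge0// expR_gt0.
apply: (@le_trans _ _ (C * expR (k * `|x|) * (normal_peak 1 * expR (- (x ^+ 2 / 2))))).
  by rewrite ler_wpM2r// mulr_ge0 ?expR_ge0 ?normal_peak_ge0.
have -> : C * expR (k * `|x|) * (normal_peak 1 * expR (- (x ^+ 2 / 2))) =
  C * normal_peak 1 * (expR (k * `|x|) * expR (- (x ^+ 2 / 2))) by ring.
rewrite -[leRHS]mulrA ler_wpM2l ?mulr_ge0 ?normal_peak_ge0//.
rewrite -!expRD ler_expR.
have := sqr_ge0 (`|x| / 2 - k); have : `|x| ^+ 2 = x ^+ 2 by rewrite real_normK ?num_real.
nra.
Qed.

(* Differentiating in [h] after moving the shift from [F] to the density is the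
   Gaussian integration by parts formula, without regularity of [F]. *)
Lemma is_derive_gauss_shift (F : R -> R) (C : R) : measurable_fun setT F ->
  (forall x, `|F x| <= C * expR `|x|) ->
  is_derive (0 : R) 1 (fun h => \int[gauss]_x F (x + h))
    (\int[gauss]_x (x * F x)).
Proof.
move=> mF FC.
have C0 : 0 <= C.
  by have := le_trans (normr_ge0 _) (FC 0); rewrite pmulr_lge0// expR_gt0.
pose p := @normal_pdf R 0 1.
have pE x : p x = normal_peak 1 * expR (- (x ^+ 2 / 2)) by exact: normal_pdf01E.
have mp : measurable_fun setT p by exact: measurable_normal_pdf.
have mshift h : measurable_fun setT (fun x : R => x - h).
  by apply: measurable_funB.
have mps (h : R) : measurable_fun setT (fun x : R => p (x - h)) by exact: measurableT_comp.
(* For [|h| <= 1] one has [|x| + |x - h| - (x - h) ^+ 2 / 2 <= 3 * |x| + 1 - x ^+ 2 / 2] and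
   [3 * |x| <= 9 + x ^+ 2 / 4], whence the exponent [10]. The factor [expR |x - h|] in [key] is
   there to absorb the [x - h] produced by differentiating the density. *)
pose K := C * normal_peak 1 * expR 10.
have K0 : 0 <= K by rewrite !mulr_ge0 ?normal_peak_ge0 ?expR_ge0.
have key (x h : R) : `|h| <= 1 -> expR `|x| * expR `|x - h| * expR (- ((x - h) ^+ 2 / 2))
    <= expR 10 * expR (- (x ^+ 2 / 4)).
  move=> h1; rewrite -!expRD ler_expR.
  have h2 : `|x - h| <= `|x| + 1.
    by rewrite (le_trans (ler_normB _ _))// lerD2l.
  have h3 : x * h <= `|x|.
    rewrite (le_trans (ler_norm _))// normrM ler_piMr//.
  have h4 := sqr_ge0 (`|x| / 2 - 3).
  have h5 := sqr_ge0 h.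
  have : `|x| ^+ 2 = x ^+ 2 by rewrite real_normK ?num_real.
  nra.
have bound (x h : R) : `|h| <= 1 -> `|F x * ((x - h) * p (x - h))| <= K * expR (- (x ^+ 2 / 4)).
  move=> h1; rewrite !normrM pE (ger0_norm (mulr_ge0 _ _)) ?normal_peak_ge0 ?expR_ge0//.
  rewrite /K.
  apply: (@le_trans _ _ (C * expR `|x| * (expR `|x - h| * (normal_peak 1 * expR (- ((x - h) ^+ 2 / 2)))))).
    apply: ler_pM => //; first by rewrite !mulr_ge0 ?normal_peak_ge0 ?expR_ge0.
    apply: ler_wpM2r; first by rewrite mulr_ge0 ?normal_peak_ge0 ?expR_ge0.
    by apply: le_trans (expR_ge1Dx _); rewrite lerDr.
  have -> : C * expR `|x| * (expR `|x - h| * (normal_peak 1 * expR (- ((x - h) ^+ 2 / 2)))) =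
    C * normal_peak 1 * (expR `|x| * expR `|x - h| * expR (- ((x - h) ^+ 2 / 2))) by ring.
  by rewrite -[leRHS]mulrA ler_wpM2l ?key// mulr_ge0 ?normal_peak_ge0.
have boundp (x h : R) : `|h| <= 1 -> `|F x * p (x - h)| <= K * expR (- (x ^+ 2 / 4)).
  move=> h1; rewrite !normrM pE (ger0_norm (mulr_ge0 _ _)) ?normal_peak_ge0 ?expR_ge0//.
  rewrite /K.
  apply: (@le_trans _ _ (C * expR `|x| * (expR `|x - h| * (normal_peak 1 * expR (- ((x - h) ^+ 2 / 2)))))).
    apply: ler_pM => //; first by rewrite !mulr_ge0 ?normal_peak_ge0 ?expR_ge0.
    apply: ler_peMl; first by rewrite mulr_ge0 ?normal_peak_ge0 ?expR_ge0.
    by apply: le_trans (expR_ge1Dx _); rewrite lerDl.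
  have -> : C * expR `|x| * (expR `|x - h| * (normal_peak 1 * expR (- ((x - h) ^+ 2 / 2)))) =
    C * normal_peak 1 * (expR `|x| * expR `|x - h| * expR (- ((x - h) ^+ 2 / 2))) by ring.
  by rewrite -[leRHS]mulrA ler_wpM2l ?key// mulr_ge0 ?normal_peak_ge0.
have dp (x h : R) : is_derive h 1 (fun h : R => F x * p (x - h)) (F x * ((x - h) * p (x - h))).
  have -> : (fun h : R => F x * p (x - h)) =
      (fun h : R => F x * normal_peak 1 * expR (- ((x - h) ^+ 2 / 2))).
    by apply/funext => k; rewrite pE mulrA.
  rewrite pE.
  have d1 : is_derive h 1 (fun h : R => - ((x - h) ^+ 2 / 2)) (x - h).
    have -> : (fun h : R => - ((x - h) ^+ 2 / 2)) = (- (1 / 2)) \*: ((cst x - id) ^+ 2 : R -> R).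
      by apply/funext => k /=; rewrite /GRing.scale/= !fctE; field.
    by apply: is_derive_eq; rewrite /GRing.scale/= !fctE; field.
  have d2 := @is_derive1_comp _ expR _ h _ _ (is_derive_expR _) d1.
  have d3 := is_deriveZ (F x * normal_peak 1) d2.
  apply: (is_derive_eq d3); rewrite /GRing.scale/=; ring.
pose f (h x : R) := F x * p (x - h).
have mf h : measurable_fun setT (f h) by exact: measurable_funM.
have intf h : `|h| <= 1 -> leb.-integrable setT (EFin \o f h).
  by move=> h1; apply: (@integrable_subgaussian _ K) => // x; exact: boundp.
have I1 (h : R) : `]-1, 1[%classic h -> `|h| <= 1.
  by rewrite /= in_itv/= ler_norml => /andP[h1 h2]; rewrite !ltW.
have DE h : \int[gauss]_x F (x + h) = \int[leb]_x f h x.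
  have mFs : measurable_fun setT (fun x : R => F (x + h)).
    by apply: measurableT_comp => //; exact: measurable_funD.
  have Fs (x : R) : `|F (x + h)| <= (C * expR `|h|) * expR (1 * `|x|).
    rewrite (le_trans (FC _))// mul1r -mulrA ler_wpM2l// -expRD ler_expR addrC.
    exact: ler_normD.
  have Fi := integrable_gauss_exp mFs Fs.
  transitivity (\int[leb]_x (F (x + h) * normal_pdf 0 1 x)).
    exact: Rintegral_normal.
  rewrite -(@Rintegral_lebesgue_shift _ (- h) (fun x => F (x + h) * normal_pdf 0 1 x)).
  - apply: eq_Rintegral => x _; rewrite /f /p (addrC (- h)) subrK//.
  - by apply: measurable_funM => //.
  - exact: integrable_normalP.
have pd h x : partial1of2 f h x = F x * ((x - h) * p (x - h)).
  by rewrite partial1of2E; exact: (@derive_val _ _ _ _ _ _ _ (dp x h)).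
rewrite (_ : (fun h => _) = (fun h => \int[leb]_x f h x)); last first.
  by apply/funext => h; exact: DE.
have G1 : leb.-integrable setT (EFin \o (fun x : R => K * expR (- (x ^+ 2 / 4)))).
  apply: (@integrable_subgaussian _ K).
    apply: measurable_funM => //; apply: measurableT_comp => //.
    by apply: measurableT_comp => //; apply: measurable_funM => //; exact: measurable_funX.
  by move=> x; rewrite ger0_norm// mulr_ge0 ?expR_ge0.
have I0 : `]-1, 1[%classic (0 : R) by rewrite /= in_itv/=; apply/andP; split; lra.
have H1 h : `]-1, 1[%classic h -> leb.-integrable setT (EFin \o f h).
  by move/I1; exact: intf.
have H2 h (x : R) : `]-1, 1[%classic h -> setT x -> derivable (f ^~ x) h 1.
  by move=> _ _; exact: ex_derive.
have H3 (x : R) : 0 <= K * expR (- (x ^+ 2 / 4)) by rewrite mulr_ge0 ?expR_ge0.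
have H4 h (x : R) : `]-1, 1[%classic h -> setT x ->
    `|partial1of2 f h x| <= K * expR (- (x ^+ 2 / 4)).
  by move=> /I1 h1 _; rewrite pd; exact: bound.
have D1 := derivable_under_integral measurableT I0 H1 H2 H3 G1 H4.
have D2 := differentiation_under_integral measurableT I0 H1 H2 H3 G1 H4.
apply: DeriveDef => //.
rewrite -derive1E D2.
have mxF : measurable_fun setT (fun x : R => x * F x) by exact: measurable_funM.
have xF (x : R) : `|x * F x| <= C * expR (2 * `|x|).
  rewrite normrM mulrDl mul1r expRD mulrCA ler_pM//.
  by apply: le_trans (expR_ge1Dx _); rewrite lerDr.
rewrite Rintegral_normal//; last exact: integrable_gauss_exp xF.
by apply: eq_Rintegral => x _; rewrite pd subr0 /p; ring.
Qed.

End StandardNormal.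

(** * Moments and characteristic function of the standard normal law, in real form *)

Section GaussFourier.
Context {R : realType}.
Local Notation gauss := (normal_prob (0 : R) 1).

Lemma gauss_integral1 : \int[gauss]_x (1 : R) = 1.
Proof. exact: Rintegral_probability_cst. Qed.

Lemma bounded_le_exp (F : R -> R) (C : R) (x : R) : (forall x, `|F x| <= C) ->
  `|F x| <= C * expR `|x|.
Proof.
move=> FC; have C0 : 0 <= C := le_trans (normr_ge0 _) (FC 0).
rewrite (le_trans (FC x))// ler_peMr// -expR0 ler_expR//.
Qed.

Lemma id_le_exp (x : R) : `|x| <= 1 * expR `|x|.
Proof. by rewrite mul1r (le_trans _ (expR_ge1Dx _))// lerDr. Qed.

Lemma integrable_gauss_id : gauss.-integrable setT (EFin \o (fun x : R => x)).
Proof.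
apply: (@integrable_gauss_exp _ _ 1 1) => // x; rewrite (mul1r `|x|); exact: id_le_exp.
Qed.

Lemma norm_integrable_gauss_id :
  gauss.-integrable setT (EFin \o (fun x : R => `|x|)).
Proof. exact: (integrable_norm integrable_gauss_id). Qed.

(** Integration by parts applied to the constant [1]: its shifts all have integral [1], so the
    derivative vanishes. [gauss_sqr_mean] repeats this with the identity, whose shift by [h] has
    integral [h]. *)
Lemma gauss_mean : \int[gauss]_x (x : R) = 0.
Proof.
have b (x : R) : `|(1 : R)| <= 1 * expR `|x|.
  by apply: (@bounded_le_exp (cst 1)) => y; rewrite normr1.
have m1 : measurable_fun setT (fun _ : R => (1 : R)) by [].
have := @is_derive_gauss_shift R _ _ m1 b.
rewrite gauss_integral1 => D1.
have E := @derive_val _ _ _ _ _ _ _ D1.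
rewrite derive_cst in E; rewrite [RHS]E.
by apply: eq_Rintegral => x _; rewrite mulr1.
Qed.

Lemma gauss_sqr_mean : \int[gauss]_x (x * x : R) = 1.
Proof.
have m1 : measurable_fun setT (fun x : R => x) by [].
have D1 := @is_derive_gauss_shift R _ _ m1 id_le_exp.
have E := @derive_val _ _ _ _ _ _ _ D1.
rewrite -E.
rewrite (_ : (fun h => _) = (fun h : R => h)); last first.
  apply/funext => h; rewrite RintegralD//; last 2 first.
  - exact: integrable_gauss_id.
  - by apply: (@bounded_integrable _ _ _ gauss (cst h) `|h|).
  by rewrite gauss_mean add0r Rintegral_probability_cst.
by rewrite derive_id.
Qed.

Lemma measurable_cosM (t u : R) : measurable_fun setT (fun x : R => cos (t * x + u)).
Proof.
apply: measurableT_comp.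
  by apply: continuous_measurable_fun; exact: continuous_cos.
by apply: measurable_funD => //; exact: measurable_funM.
Qed.

Lemma measurable_sinM (t : R) : measurable_fun setT (fun x : R => sin (t * x)).
Proof.
apply: measurableT_comp.
  by apply: continuous_measurable_fun; exact: continuous_sin.
exact: measurable_funM.
Qed.

Let C (t : R) := \int[gauss]_x cos (t * x).
Let S (t : R) := \int[gauss]_x sin (t * x).

Let mcos t : measurable_fun setT (fun x : R => cos (t * x)).
Proof.
rewrite (_ : (fun _ => _) = (fun x => cos (t * x + 0))).
  exact: measurable_cosM.
by apply/funext => x; rewrite addr0.
Qed.

Let cos_le1 (x : R) : `|cos x| <= 1.
Proof. by rewrite ler_norml cos_geN1 cos_le1. Qed.

Let sin_le1 (x : R) : `|sin x| <= 1.
Proof. by rewrite ler_norml sin_geN1 sin_le1. Qed.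

Let icos t : gauss.-integrable setT (fun x : R => (cos (t * x))%:E).
Proof. exact: (@bounded_integrable _ _ _ gauss _ 1 (mcos t)). Qed.

Let isin t : gauss.-integrable setT (fun x : R => (sin (t * x))%:E).
Proof.
exact: (@bounded_integrable _ _ _ gauss _ 1 (measurable_sinM t)).
Qed.

Let is_derive_cosM (t h : R) : is_derive h 1 (fun h : R => cos (t * h)) (- t * sin (t * h)).
Proof.
have d1 : is_derive h 1 (fun h : R => t * h) t.
  have := @is_deriveZ R R^o R^o (fun x : R^o => x) t h 1 1 _; rewrite /GRing.scale/= mulr1; exact.
have := @is_derive1_comp _ cos _ h _ _ (is_derive_cos _) d1.
by move=> D; apply: (is_derive_eq D); ring.
Qed.

Let is_derive_sinM (t h : R) : is_derive h 1 (fun h : R => sin (t * h)) (t * cos (t * h)).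
Proof.
have d1 : is_derive h 1 (fun h : R => t * h) t.
  have := @is_deriveZ R R^o R^o (fun x : R^o => x) t h 1 1 _; rewrite /GRing.scale/= mulr1; exact.
have := @is_derive1_comp _ sin _ h _ _ (is_derive_sin _) d1.
by move=> D; apply: (is_derive_eq D); ring.
Qed.

(** By integration by parts the left-hand side is the derivative at [h = 0] of the integral of
    [sin (t * (x + h))], which the addition formula expands as
    [S t * cos (t * h) + C t * sin (t * h)]. Together with [int_xcos] this closes the differential
    equations for [C] and [S]. *)
Let int_xsin t : \int[gauss]_x (x * sin (t * x)) = t * C t.
Proof.
have b (x : R) : `|sin (t * x)| <= 1 * expR `|x|.
  exact: (@bounded_le_exp (fun x => sin (t * x))).
have D1 := @is_derive_gauss_shift R _ _ (measurable_sinM t) b.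
rewrite -(@derive_val _ _ _ _ _ _ _ D1).
have -> : (fun h => \int[gauss]_x sin (t * (x + h))) =
    (fun h : R => S t * cos (t * h) + C t * sin (t * h)).
  apply/funext => h; rewrite /S /C -(@RintegralZr _ _ _ gauss _ _ _ measurableT (isin t))
    -(@RintegralZr _ _ _ gauss _ _ _ measurableT (icos t)) -RintegralD//.
  - by apply: eq_Rintegral => x _; rewrite mulrDr sinD.
  - exact: (integrableZr _ _ (isin t)).
  - exact: (integrableZr _ _ (icos t)).
have D := is_deriveD (is_deriveZ (S t) (is_derive_cosM t 0))
  (is_deriveZ (C t) (is_derive_sinM t 0)).
rewrite (@derive_val _ _ _ _ _ _ _ D) /GRing.scale/= !mulr0 sin0 cos0; ring.
Qed.

Let int_xcos t : \int[gauss]_x (x * cos (t * x)) = - t * S t.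
Proof.
have b (x : R) : `|cos (t * x)| <= 1 * expR `|x|.
  exact: (@bounded_le_exp (fun x => cos (t * x))).
have D1 := @is_derive_gauss_shift R _ _ (mcos t) b.
rewrite -(@derive_val _ _ _ _ _ _ _ D1).
have -> : (fun h => \int[gauss]_x cos (t * (x + h))) =
    (fun h : R => C t * cos (t * h) - S t * sin (t * h)).
  apply/funext => h; rewrite /S /C -(@RintegralZr _ _ _ gauss _ _ _ measurableT (isin t))
    -(@RintegralZr _ _ _ gauss _ _ _ measurableT (icos t)) -RintegralB//.
  - by apply: eq_Rintegral => x _; rewrite mulrDr cosD.
  - exact: (integrableZr _ _ (icos t)).
  - exact: (integrableZr _ _ (isin t)).
have D := is_deriveB (is_deriveZ (C t) (is_derive_cosM t 0))
  (is_deriveZ (S t) (is_derive_sinM t 0)).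
rewrite (@derive_val _ _ _ _ _ _ _ D) /GRing.scale/= !mulr0 sin0 cos0; ring.
Qed.

(** The product of [y] with the integrating factor [expR (u ^+ 2 / 2)] has zero derivative, hence is
    constant. *)
Let gauss_ode (y : R -> R) : (forall t : R, is_derive t 1 y (- t * y t)) ->
  forall t, y t = y 0 * expR (- (t ^+ 2 / 2)).
Proof.
move=> dy t.
have dE (u : R) : is_derive u 1 (fun u : R => expR (u ^+ 2 / 2)) (u * expR (u ^+ 2 / 2)).
  have d1 : is_derive u 1 (fun u : R => u ^+ 2 / 2) u.
    have -> : (fun u : R => u ^+ 2 / 2) = (1 / 2) \*: (id ^+ 2 : R -> R).
      by apply/funext => k /=; rewrite /GRing.scale/= !fctE; field.
    by apply: is_derive_eq; rewrite /GRing.scale/=; field.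
  have D := @is_derive1_comp _ expR _ u _ _ (is_derive_expR _) d1.
  by apply: (is_derive_eq D); ring.
have dz (u : R) : is_derive u 1 (y * (fun u : R => expR (u ^+ 2 / 2))) 0.
  have := dy u; have := dE u => d1 d2.
  apply: is_derive_eq; rewrite /GRing.scale/=; ring.
have := is_derive_0_is_cst t 0 dz; rewrite !fctE expr0n/= mul0r expR0 mulr1 => <-.
by rewrite -mulrA -expRD subrr expR0 mulr1.
Qed.

Lemma gauss_cos (t : R) : \int[gauss]_x cos (t * x) = expR (- (t ^+ 2 / 2)).
Proof.
have C0 : C 0 = 1.
  rewrite -[RHS]gauss_integral1; apply: eq_Rintegral => x _.
  by rewrite mul0r cos0.
suff dC (u : R) : is_derive u 1 C (- u * C u).
  by rewrite -[LHS]/(C t) (gauss_ode dC t) C0 mul1r.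
have D : is_derive u 1 C (\int[gauss]_x (- x * sin (u * x))).
  apply: (@is_derive_Rintegral _ _ _ gauss _ (fun u x => cos (u * x))
    (fun u x => - x * sin (u * x)) u norm_integrable_gauss_id icos).
  - move=> v x; rewrite (_ : (fun u => _) = (fun u => cos (x * u))).
      by rewrite (mulrC v); exact: is_derive_cosM.
    by apply/funext => w; rewrite mulrC.
  - move=> v x; rewrite normrM normrN ler_piMr//.
apply: (is_derive_eq D); rewrite mulNr -int_xsin -mulN1r -RintegralZl//; last first.
  apply: (@integrable_gauss_exp _ _ 1 1) => [|x].
    by apply: measurable_funM => //; exact: measurable_sinM.
  by rewrite (mul1r `|x|) (le_trans _ (id_le_exp x))// normrM ler_piMr.
by apply: eq_Rintegral => x _; rewrite mulN1r mulNr.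
Qed.

(** [S] solves the same linear equation as [C], but starts from [0]. *)
Lemma gauss_sin (t : R) : \int[gauss]_x sin (t * x) = 0.
Proof.
have S0 : S 0 = 0.
  transitivity (\int[gauss]_x (0 : R)); last exact: Rintegral_probability_cst.
  by apply: eq_Rintegral => x _; rewrite mul0r sin0.
suff dS (u : R) : is_derive u 1 S (- u * S u).
  by rewrite -[LHS]/(S t) (gauss_ode dS t) S0 mul0r.
rewrite -int_xcos.
apply: (@is_derive_Rintegral _ _ _ gauss _ (fun u x => sin (u * x))
    (fun u x => x * cos (u * x)) u norm_integrable_gauss_id isin).
- move=> v x; rewrite (_ : (fun u => _) = (fun u => sin (x * u))).
    by rewrite (mulrC v); exact: is_derive_sinM.
  by apply/funext => w; rewrite mulrC.
- by move=> v x; rewrite normrM ler_piMr.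
Qed.

(** The phase [u] makes a real cosine as informative as the complex exponential: [u = 0] and
    [u = - (pi / 2)] recover its real and imaginary parts. *)
Lemma gauss_cosD (t u : R) :
  \int[gauss]_x cos (t * x + u) = cos u * expR (- (t ^+ 2 / 2)).
Proof.
have -> : \int[gauss]_x cos (t * x + u) = C t * cos u - S t * sin u.
  rewrite /C /S -(@RintegralZr _ _ _ gauss _ _ _ measurableT (isin t))
    -(@RintegralZr _ _ _ gauss _ _ _ measurableT (icos t)) -RintegralB//.
  - by apply: eq_Rintegral => x _; rewrite cosD.
  - exact: (integrableZr _ _ (icos t)).
  - exact: (integrableZr _ _ (isin t)).
by rewrite /C gauss_cos /S gauss_sin; ring.
Qed.

End GaussFourier.

(** * Reduction of arbitrary one-dimensional Gaussian laws to the standard one *)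

Section GaussianLaw.
Context {R : realType}.
Local Notation leb := (@lebesgue_measure R).
Local Notation gauss := (normal_prob (0 : R) 1).

Lemma eq_law_integral d1 d2 (T1 : measurableType d1) (T2 : measurableType d2)
    (m1 : {measure set T1 -> \bar R}) (m2 : {measure set T2 -> \bar R})
    (X1 : T1 -> R) (X2 : T2 -> R) (g : R -> R) :
  measurable_fun setT X1 -> measurable_fun setT X2 -> measurable_fun setT g ->
  (forall B, measurable B -> m1 (X1 @^-1` B) = m2 (X2 @^-1` B)) ->
  m2.-integrable setT (fun x => (g (X2 x))%:E) ->
  m1.-integrable setT (fun x => (g (X1 x))%:E) /\
  \int[m1]_x g (X1 x) = \int[m2]_x g (X2 x).
Proof.
move=> mX1 mX2 mg E i2.
have mgE : measurable_fun setT (EFin \o g) by exact/measurable_EFinP.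
have E' (h : R -> \bar R) : (\int[pushforward m1 X1]_x h x = \int[pushforward m2 X2]_x h x)%E.
  by apply: eq_measure_integral => A mA _; exact: E.
have mgA : measurable_fun setT (fun y : R => `|g y|%:E).
  by apply/measurable_EFinP; exact: measurableT_comp.
have gA : {in [set: R], forall y, 0 <= `|g y|%:E}%E by move=> y _; rewrite lee_fin.
have i1 : m1.-integrable setT (fun x => (g (X1 x))%:E).
  apply/integrableP; split.
    by apply/measurable_EFinP; exact: measurableT_comp.
  have /integrableP[_] := i2; apply: le_lt_trans.
  have e1 := ge0_integral_pushforward mX1 m1 measurableT mgA gA.
  have e2 := ge0_integral_pushforward mX2 m2 measurableT mgA gA.
  have := E' (fun x => `|g x|%:E); rewrite e1 e2 !preimage_setT => e3.
  by rewrite [X in (X <= _)%E]e3.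
split => //; rewrite /Rintegral; congr fine.
have e1 := integral_pushforward mX1 mgE i1 measurableT.
have e2 := integral_pushforward mX2 mgE i2 measurableT.
by have := E' (EFin \o g); rewrite e1 e2 !preimage_setT.
Qed.

Lemma normal_prob_affine (m s : R) (B : set R) : 0 < s -> measurable B ->
  normal_prob m s B = gauss ((fun x => m + s * x) @^-1` B).
Proof.
move=> s0 mB.
have mphi : measurable_fun setT (fun x : R => m + s * x).
  by apply: measurable_funD => //; exact: measurable_funM.
have mpB : measurable ((fun x : R => m + s * x) @^-1` B).
  by rewrite -[X in measurable X]setTI; exact: mphi.
rewrite /normal_prob integral_mkcond [RHS]integral_mkcond.
have s0' : s != 0 by rewrite gt_eqF.
transitivity (\int[leb]_x (\1_B x * normal_pdf m s x)%:E)%E.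
  apply: eq_integral => x _; rewrite patchE indicE.
  by case: ifP => _; rewrite ?mul1r ?mul0r.
rewrite (integral_lebesgue_affine m s0); last 2 first.
- by apply: measurable_funM => //; exact: measurable_normal_pdf.
- by move=> x; rewrite mulr_ge0// ?normal_pdf_ge0// indicE.
rewrite -ge0_integralZl//; last 3 first.
- apply/measurable_EFinP.
  apply: (measurableT_comp (f := fun x : R => \1_B x * normal_pdf m s x)) => //.
  by apply: measurable_funM => //; exact: measurable_normal_pdf.
- by move=> x _; rewrite lee_fin mulr_ge0// ?normal_pdf_ge0// indicE.
- by rewrite lee_fin ltW.
apply: eq_integral => x _; rewrite patchE indicE -EFinM.
have -> : (m + s * x \in B) = (x \in (fun x => m + s * x) @^-1` B).
  by apply/idP/idP; rewrite !inE.
case: ifP => _; last by rewrite mul0r mulr0.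
rewrite mul1r; congr EFin.
rewrite normal_pdf01E normal_pdfE// /normal_fun mulrA; congr (_ * expR _).
  rewrite /normal_peak expr1n mul1r -mulrnAr sqrtrM ?sqr_ge0// sqrtr_sqr gtr0_norm//.
  by rewrite invfM mulrA divff// mul1r.
by rewrite addrC addKr; field.
Qed.

(** The map [x |-> m + s * x] also covers [s = 0], where it is constant and the law is a Dirac mass,
    so degenerate linear forms need no separate treatment afterwards. *)
Lemma Rintegral_gaussian_law d (T : measurableType d) (P : probability T R)
    (U : T -> R) :
  measurable_fun setT U -> gaussian_law (pushforward P U) ->
  exists m s, 0 <= s /\ forall g : R -> R, measurable_fun setT g ->
    gauss.-integrable setT (fun x => (g (m + s * x))%:E) ->
    P.-integrable setT (fun w => (g (U w))%:E) /\
    \int[P]_w g (U w) = \int[gauss]_x g (m + s * x).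
Proof.
move=> mU [m [s [s0 law]]]; exists m, s; split => // g mg gi.
apply: (@eq_law_integral _ _ _ _ P gauss U (fun x : R => m + s * x)) => //.
  by apply: measurable_funD => //; exact: measurable_funM.
move=> B mB; rewrite -[LHS]/(pushforward P U B) (law B mB).
case: ifPn => [/eqP ->|sn0]; last first.
  by apply: normal_prob_affine => //; rewrite lt_neqAle eq_sym sn0.
rewrite diracE; case: (boolP (m \in B)) => mB'.
  have -> : (fun x : R => m + 0 * x) @^-1` B = setT.
    by apply/seteqP; split => // x _ /=; rewrite mul0r addr0; exact: set_mem.
  by rewrite [RHS]probability_setT.
have -> : (fun x : R => m + 0 * x) @^-1` B = set0.
  apply/seteqP; split => // x /=; rewrite mul0r addr0 => /mem_set.
  by rewrite (negbTE mB').
by rewrite measure0.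
Qed.

End GaussianLaw.

(** * The one-dimensional inequality for monotone functions *)

Section GaussMonotone.
Context {R : realType}.
Local Notation leb := (@lebesgue_measure R).
Local Notation gauss := (normal_prob (0 : R) 1).

(** The boolean [b] treats a half-line and its complement at once; the factors in [cramer_wold] and
    [excursion_indicE] have this shape. *)
Lemma measurable_ge_indic d (T : measurableType d) (X : T -> R) (a : R) (b : bool) :
  measurable_fun setT X -> measurable_fun setT (fun w => ((a <= X w)%R == b)%:R : R).
Proof.
move=> mX.
have m1 : measurable_fun setT (fun x : R => ((a <= x)%R == b)%:R : R).
  rewrite (_ : (fun _ => _) =
      \1_(if b then `[a, +oo[%classic else `]-oo, a[%classic)); last first.
    apply/funext => x; rewrite indicE; congr ((nat_of_bool _)%:R); case: (b).
      by rewrite eqb_id; apply/idP/idP; rewrite inE/= in_itv/= andbT.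
    by rewrite eqbF_neg -ltNge; apply/idP/idP; rewrite inE/= in_itv/=.
  by case: (b); exact: measurable_indic.
exact: (measurableT_comp m1 mX).
Qed.

Lemma measurable_geT_indic d (T : measurableType d) (X : T -> R) (a : R) :
  measurable_fun setT X -> measurable_fun setT (fun w => (a <= X w)%R%:R : R).
Proof.
move=> mX; rewrite (_ : (fun w => _) = (fun w => ((a <= X w)%R == true)%:R)).
  exact: measurable_ge_indic.
by apply/funext => w; rewrite eqb_id.
Qed.

Lemma gauss_gt0 (f : R -> R) (a : R) : measurable_fun setT f ->
  (forall x, 0 <= f x <= 1) -> (forall x, a <= x <= a + 1 -> f x = 1) ->
  0 < \int[gauss]_x f x.
Proof.
move=> mf f01 f1.
have fi : gauss.-integrable setT (EFin \o f).
  apply: (@bounded_integrable _ _ _ gauss f 1) => // x.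
  by rewrite ger0_norm; case/andP: (f01 x).
rewrite Rintegral_normal//.
(* On [[a, a + 1]] one has [|x| <= |a| + 1], so the density is at least [c] there. *)
pose c := normal_peak 1 * expR (- ((`|a| + 1) ^+ 2 / 2)) : R.
have c0 : 0 < c by rewrite mulr_gt0 ?expR_gt0 ?normal_peak_gt0 ?oner_neq0.
have I1 : leb.-integrable setT (fun x => (\1_`[a, a + 1] x)%:E).
  by apply: integrable_indic_itv.
apply: (@lt_le_trans _ _ (\int[leb]_x (c * \1_`[a, a + 1] x))).
  rewrite RintegralZl// mulr_gt0// /Rintegral integral_indic// setIT.
  have E := lebesgue_measure_itv `[a, a + 1].
  by rewrite [X in fine X]E/= lte_fin ltrDl ltr01 -EFinB/= addrAC subrr add0r.
apply: le_Rintegral => //.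
- by have := integrableZl (R := R) measurableT c I1.
- exact: integrable_normalP.
move=> x _; rewrite indicE; case: (boolP (x \in _)) => [|_]; last first.
  by rewrite mulr0 mulr_ge0 ?normal_pdf_ge0//; case/andP: (f01 x).
rewrite inE/= in_itv/= => xa; rewrite f1// mulr1 mul1r normal_pdf01E.
rewrite ler_wpM2l ?normal_peak_ge0// ler_expR lerN2 ler_pM2r// -(real_normK (num_real x)).
rewrite ler_sqr ?nnegrE ?addr_ge0//; case/andP: xa => x1 x2.
have := ler_norm a; have := ler_norm (- a); rewrite normrN => h1 h2.
by rewrite ler_norml; apply/andP; split; lra.
Qed.

Let H (a x : R) : R := (a <= x)%R%:R.
Let L (a x : R) : R := (x < a)%R%:R.

(* With [w := f - f 0], the integrand [w x * x] is nonnegative and controls [`|w x|]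
   outside [-1, 1]; inside, monotonicity bounds [w] by its values at [1] and [-1],
   which are controlled by the integral over the tails. *)
Lemma gauss_monotone_bound (M : R) : exists2 c : R, 0 < c &
  forall (f : R -> R) (a : R), measurable_fun setT f ->
  {homo f : x y / x <= y} -> (forall x, 0 <= f x <= 1) -> - M < a < M ->
  0 <= \int[gauss]_x (x * f x) /\
  c * ((\int[gauss]_x (f x * (a <= x)%R%:R)) / (\int[gauss]_x (a <= x)%R%:R)
     - (\int[gauss]_x (f x * (x < a)%R%:R)) / (\int[gauss]_x (x < a)%R%:R))
  <= \int[gauss]_x (x * f x).
Proof.
have mH a : measurable_fun setT (H a).
  rewrite (_ : H a = fun x => ((a <= x)%R == true)%:R); last by apply/funext => x; rewrite eqb_id.
  by apply: measurable_ge_indic.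
have mL a : measurable_fun setT (L a).
  rewrite (_ : L a = fun x => ((a <= x)%R == false)%:R); last first.
    by apply/funext => x; rewrite eqbF_neg -ltNge.
  by apply: measurable_ge_indic.
have H01 a x : 0 <= H a x <= 1 by rewrite /H; case: (a <= x); rewrite ?lexx ?ler01.
have L01 a x : 0 <= L a x <= 1 by rewrite /L; case: (x < a); rewrite ?lexx ?ler01.
have H_gt0 a : 0 < \int[gauss]_x H a x.
  by apply: (@gauss_gt0 _ a) => // x /andP[ax _]; rewrite /H ax.
have L_gt0 a : 0 < \int[gauss]_x L a x.
  apply: (@gauss_gt0 _ (a - 2)) => // x /andP[_ xa]; rewrite /L.
  by rewrite (_ : x < a)//; lra.
(* A lower bound for both conditioning probabilities, uniform in [a]: the mass above [a] is at least
   the mass above [M], and the mass below [a] at least the mass below [- M]. *)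
pose m0 := Num.min (\int[gauss]_x H M x) (\int[gauss]_x L (- M) x).
have m0_gt0 : 0 < m0 by rewrite lt_min H_gt0 L_gt0.
(* The three terms bound, in units of [J], the integral of [w x * x], the value [w 1] and the value
   [- w (-1)]; see [wJ]. *)
pose D := 1 + (\int[gauss]_x H 1 x)^-1 + (\int[gauss]_x L (- 1) x)^-1.
have D_gt0 : 0 < D by rewrite !addr_gt0// invr_gt0.
exists (m0 / D); first exact: divr_gt0.
move=> f a mf homf f01 /andP[aM1 aM2].
have bi (g : R -> R) : measurable_fun setT g -> (forall x, `|g x| <= 1) ->
    gauss.-integrable setT (EFin \o g) by move=> mg g1; exact: (@bounded_integrable _ _ _ gauss g 1).
have nb (g : R -> R) : (forall x, 0 <= g x <= 1) -> forall x, `|g x| <= 1.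
  by move=> g01 x; rewrite ger0_norm; case/andP: (g01 x).
have mono (g1 g2 : R -> R) : measurable_fun setT g1 -> (forall x, 0 <= g1 x <= 1) ->
    measurable_fun setT g2 -> (forall x, 0 <= g2 x <= 1) -> (forall x, g1 x <= g2 x) ->
    \int[gauss]_x g1 x <= \int[gauss]_x g2 x.
  by move=> *; apply: le_Rintegral => //; apply: bi => //; exact: nb.
have p_ge : m0 <= \int[gauss]_x H a x.
  rewrite ge_min; apply/orP; left; apply: mono => // x.
  rewrite /H; have [ax|ax] := leP a x; first by case: (M <= x).
  by rewrite (leNgt M) (lt_trans ax aM2).
have q_ge : m0 <= \int[gauss]_x L a x.
  rewrite ge_min; apply/orP; right; apply: mono => // x.
  rewrite /L; have [ax|ax] := ltP x a; first by case: (x < - M).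
  by rewrite (ltNge x (- M)) (le_trans (ltW aM1) ax).
(* Subtracting [f 0] changes neither side: the normal law has mean [0], and the constant cancels in
   the difference of the two conditional means. *)
pose w x := f x - f 0.
have mw : measurable_fun setT w by apply: measurable_funB.
have w1 x : `|w x| <= 1.
  by have := f01 x; have := f01 0; rewrite /w ler_norml => /andP[h1 h2] /andP[h3 h4]; apply/andP; split; lra.
have wx x : 0 <= w x * x.
  have [x0|x0] := leP 0 x; first by rewrite mulr_ge0// subr_ge0 homf.
  by apply: mulr_le0; [rewrite subr_le0 homf// ltW|exact: ltW].
pose J := \int[gauss]_x (x * f x).
have ixw : gauss.-integrable setT (fun x => (w x * x)%:E).
  apply: (@integrable_gauss_exp _ (fun x => w x * x) 1 1) => [|x].
    exact: measurable_funM.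
  rewrite (mul1r `|x|) (le_trans _ (id_le_exp x))// normrM ler_piMl//.
have JE : J = \int[gauss]_x (w x * x).
  rewrite -[J]subr0 -[X in _ - X](mulr0 (f 0)) -[X in _ * X](@gauss_mean R).
  rewrite -RintegralZl//; last exact: integrable_gauss_id.
  rewrite -RintegralB//.
  - by apply: eq_Rintegral => x _; rewrite /w mulrBl (mulrC x).
  - apply: (@integrable_gauss_exp _ (fun x => x * f x) 1 1) => [|x].
      exact: measurable_funM.
    by rewrite (mul1r `|x|) (le_trans _ (id_le_exp x))// normrM ler_piMr// nb.
  - exact: (integrableZl measurableT (f 0) (@integrable_gauss_id R)).
have iw : gauss.-integrable setT (fun x => `|w x|%:E).
  apply: (@bounded_integrable _ _ _ gauss (fun x => `|w x|) 1) => [|x].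
    exact: measurableT_comp.
  by rewrite normr_id.
have iwH b : gauss.-integrable setT (fun x => (w x * H b x)%:E).
  apply: (bi (fun x => w x * H b x)) => [|x]; first exact: measurable_funM.
  by rewrite normrM mulr_ile1// nb.
have iwL b : gauss.-integrable setT (fun x => (w x * L b x)%:E).
  apply: (bi (fun x => w x * L b x)) => [|x]; first exact: measurable_funM.
  by rewrite normrM mulr_ile1// nb.
have iH b : gauss.-integrable setT (fun x => (H b x)%:E).
  by apply: (bi (H b)) => //; exact: nb.
have iL b : gauss.-integrable setT (fun x => (L b x)%:E).
  by apply: (bi (L b)) => //; exact: nb.
have wH1 : w 1 * \int[gauss]_x H 1 x <= J.
  rewrite JE -(RintegralZl _ measurableT (iH 1)); apply: le_Rintegral => //.
    exact: (integrableZl measurableT (w 1) (iH 1)).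
  move=> x _; rewrite /H; have [x1|x1] := leP 1 x; last by rewrite mulr0.
  rewrite mulr1 -[leLHS]mulr1 ler_pM//; first by rewrite subr_ge0 homf.
  by rewrite lerB// homf.
have wL1 : - w (-1) * \int[gauss]_x L (-1) x <= J.
  rewrite JE -(RintegralZl _ measurableT (iL (-1))); apply: le_Rintegral => //.
    by have := integrableZl (R := R) measurableT (- w (-1)) (iL (-1)).
  move=> x _; rewrite /L; have [x1|x1] := ltP x (-1); last by rewrite mulr0.
  rewrite mulr1 -(mulrNN (w x)) -[leLHS]mulr1 ler_pM//.
  - by rewrite oppr_ge0 subr_le0 homf.
  - by rewrite lerN2 lerB// homf// ltW.
  - by rewrite lerNr ltW.
have J0 : 0 <= J by rewrite JE Rintegral_ge0.
have w1J : w 1 <= (\int[gauss]_x H 1 x)^-1 * J.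
  by rewrite mulrC ler_pdivlMr.
have w2J : - w (-1) <= (\int[gauss]_x L (-1) x)^-1 * J.
  by rewrite mulrC ler_pdivlMr.
have wb x : `|w x| <= w x * x + (w 1 - w (-1)).
  have w10 : 0 <= w 1 by rewrite subr_ge0 homf.
  have w20 : w (-1) <= 0 by rewrite subr_le0 homf.
  have [x0|x0] := leP 0 x.
    have wx0 : 0 <= w x by rewrite subr_ge0 homf.
    rewrite ger0_norm//; have [x1|x1] := leP 1 x.
      have : w x * 1 <= w x * x by rewrite ler_wpM2l.
      lra.
    have : w x <= w 1 by rewrite lerB// homf// ltW.
    have := wx x; lra.
  have wx0 : w x <= 0 by rewrite subr_le0 homf// ltW.
  rewrite ler0_norm//; have [x1|x1] := ltP x (-1).
    have : - w x * 1 <= - w x * (- x) by rewrite ler_wpM2l; lra.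
    rewrite mulrNN; lra.
  have : w (-1) <= w x by rewrite lerB// homf.
  have := wx x; lra.
have wJ : \int[gauss]_x `|w x| <= D * J.
  apply: (@le_trans _ _ (\int[gauss]_x (w x * x + (w 1 - w (-1))))).
    apply: le_Rintegral => //.
    apply: (@integrable_gauss_exp _ (fun x => w x * x + (w 1 - w (-1))) 3 1) => [|x].
      by apply: measurable_funD => //; exact: measurable_funM.
    rewrite (mul1r `|x|) (le_trans (ler_normD _ _))//.
    have h1 : `|w x * x| <= 1 * expR `|x|.
      by rewrite (le_trans _ (id_le_exp x))// normrM ler_piMl.
    have h2 : `|w 1 - w (-1)| <= 2.
      rewrite (le_trans (ler_normB _ _))// (_ : 2 = 1 + 1)// lerD//.
    have h3 : 1 <= expR `|x| by rewrite -expR0 ler_expR.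
    lra.
  rewrite RintegralD//; last first.
    by apply: (@bounded_integrable _ _ _ gauss (cst (w 1 - w (-1))) `|w 1 - w (-1)|).
  rewrite Rintegral_probability_cst -JE /D. lra.
have IE1 b : \int[gauss]_x (f x * H b x) = \int[gauss]_x (w x * H b x) + f 0 * \int[gauss]_x H b x.
  rewrite -(RintegralZl _ measurableT (iH b)) -RintegralD//; last 2 first.
  - exact: iwH.
  - exact: (integrableZl measurableT (f 0) (iH b)).
  by apply: eq_Rintegral => x _; rewrite /w; ring.
have IE2 b : \int[gauss]_x (f x * L b x) = \int[gauss]_x (w x * L b x) + f 0 * \int[gauss]_x L b x.
  rewrite -(RintegralZl _ measurableT (iL b)) -RintegralD//; last 2 first.
  - exact: iwL.
  - exact: (integrableZl measurableT (f 0) (iL b)).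
  by apply: eq_Rintegral => x _; rewrite /w; ring.
split; first exact: J0.
rewrite -/(H a) -/(L a) IE1 IE2 -/J.
set p := \int[gauss]_x H a x in p_ge *; set q := \int[gauss]_x L a x in q_ge *.
have p0 : 0 < p := lt_le_trans m0_gt0 p_ge.
have q0 : 0 < q := lt_le_trans m0_gt0 q_ge.
rewrite !mulrDl !mulfK ?gt_eqF// opprD addrACA subrr addr0.
have iwHn : gauss.-integrable setT (fun x => (`|w x| * H a x)%:E).
  apply: (bi (fun x => `|w x| * H a x)) => [|x].
    by apply: measurable_funM => //; exact: measurableT_comp.
  by rewrite normrM normr_id mulr_ile1// nb.
have iwLn : gauss.-integrable setT (fun x => (`|w x| * L a x)%:E).
  apply: (bi (fun x => `|w x| * L a x)) => [|x].
    by apply: measurable_funM => //; exact: measurableT_comp.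
  by rewrite normrM normr_id mulr_ile1// nb.
(* Each conditional mean is bounded separately, with [m0] in place of its normalisation. The two
   half-lines partition the line, so by [e3] the bounds add up to the integral of [|w|] divided by
   [m0], which [wJ] controls. *)
have e1 : \int[gauss]_x (w x * H a x) / p <= \int[gauss]_x (`|w x| * H a x) / m0.
  apply: (@le_trans _ _ (\int[gauss]_x (`|w x| * H a x) / p)).
    rewrite ler_pM2r ?invr_gt0//; apply: le_Rintegral => //; first exact: iwH.
    by move=> x _; rewrite ler_wpM2r ?ler_norm//; case/andP: (H01 a x).
  rewrite ler_wpM2l ?lef_pV2//; apply: Rintegral_ge0 => x _.
  by rewrite mulr_ge0//; case/andP: (H01 a x).
have e2 : - (\int[gauss]_x (w x * L a x) / q) <= \int[gauss]_x (`|w x| * L a x) / m0.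
  apply: (@le_trans _ _ (\int[gauss]_x (`|w x| * L a x) / q)).
    rewrite -mulNr ler_pM2r ?invr_gt0// -mulN1r -(RintegralZl _ measurableT (iwL a)).
    apply: le_Rintegral => //.
      exact: (integrableZl measurableT (-1) (iwL a)).
    move=> x _; rewrite mulN1r -mulNr; apply: ler_wpM2r; first by case/andP: (L01 a x).
    by rewrite -normrN ler_norm.
  rewrite ler_wpM2l ?lef_pV2//; apply: Rintegral_ge0 => x _.
  by rewrite mulr_ge0//; case/andP: (L01 a x).
have e3 : \int[gauss]_x (`|w x| * H a x) + \int[gauss]_x (`|w x| * L a x) =
    \int[gauss]_x `|w x|.
  rewrite -RintegralD//; apply: eq_Rintegral => x _.
  by rewrite -mulrDr /H /L; case: leP; rewrite ?addr0 ?add0r mulr1.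
rewrite mulrAC ler_pdivrMr// mulrC -ler_pdivlMr//.
apply: (le_trans (lerD e1 e2)); rewrite -mulrDl e3 ler_pM2r ?invr_gt0//.
by rewrite mulrC.
Qed.

End GaussMonotone.

(** * Fubini, dominated convergence and finite sums for real-valued integrals *)

Section ProductIntegration.
Context {R : realType}.

Lemma bounded_integrable_prod d1 d2 (T1 : measurableType d1) (T2 : measurableType d2)
    (P1 : probability T1 R) (P2 : probability T2 R) (f : T1 * T2 -> R) (C : R) :
  measurable_fun setT f -> (forall x, `|f x| <= C) ->
  (P1 \x P2)%E.-integrable setT (EFin \o f).
Proof.
move=> mf fC; apply: measurable_bounded_integrable => //.
  rewrite -setXTT [X in (X < _)%E]product_measure1E//.
  rewrite (_ : (_ * _)%E = 1%E) ?ltry// -[RHS]mule1.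
  by congr (_ * _)%E; exact: probability_setT.
exists C; split; first exact: num_real.
by move=> M CM x _ /=; apply: le_trans (fC x) (ltW CM).
Qed.

Lemma bounded_fubini d1 d2 (T1 : measurableType d1) (T2 : measurableType d2)
    (P1 : probability T1 R) (P2 : probability T2 R) (f : T1 * T2 -> R) (C : R) :
  measurable_fun setT f -> (forall x, `|f x| <= C) ->
  \int[P1]_x \int[P2]_y f (x, y) = \int[P2]_y \int[P1]_x f (x, y).
Proof.
move=> mf fC; apply: Rintegral_fubini.
- exact: (bounded_integrable_prod P1 P2 mf fC).
- move=> x; apply: (@bounded_integrable _ _ _ P2 (fun y => f (x, y)) C) => //.
  exact: (measurableT_comp mf (measurable_pair1 x)).
- move=> y; apply: (@bounded_integrable _ _ _ P1 (fun x => f (x, y)) C) => //.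
  exact: (measurableT_comp mf (measurable_pair2 y)).
Qed.

Lemma bounded_prodE d1 d2 (T1 : measurableType d1) (T2 : measurableType d2)
    (P1 : probability T1 R) (P2 : probability T2 R) (f : T1 * T2 -> R) (C : R) :
  measurable_fun setT f -> (forall x, `|f x| <= C) ->
  \int[(P1 \x P2)%E]_z f z = \int[P1]_x \int[P2]_y f (x, y).
Proof.
move=> mf fC; apply: Rintegral_prod.
- exact: (bounded_integrable_prod P1 P2 mf fC).
- move=> x; apply: (@bounded_integrable _ _ _ P2 (fun y => f (x, y)) C) => //.
  exact: (measurableT_comp mf (measurable_pair1 x)).
Qed.

Lemma Rintegral_dominated_cvg d (T : measurableType d) (m : {measure set T -> \bar R})
    (f_ : (T -> R)^nat) (f g : T -> R) :
  (forall n, measurable_fun setT (f_ n)) -> measurable_fun setT f ->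
  m.-integrable setT (EFin \o g) ->
  (forall n x, `|f_ n x| <= g x) ->
  (forall x, f_ n x @[n --> \oo] --> f x) ->
  \int[m]_x f_ n x @[n --> \oo] --> \int[m]_x f x.
Proof.
move=> mf_ mf gi fg fcvg.
have mE n : measurable_fun setT (EFin \o f_ n) by exact/measurable_EFinP.
have mEf : measurable_fun setT (EFin \o f) by exact/measurable_EFinP.
have cE : {ae m, forall x, setT x -> (EFin \o f_ n) x @[n --> \oo] --> (EFin \o f) x}.
  apply: aeW => x _; apply: cvg_EFin; first exact: nearW.
  exact: fcvg.
have bE : {ae m, forall x n, setT x -> (`|(EFin \o f_ n) x| <= (EFin \o g) x)%E}.
  by apply: aeW => x n _; rewrite /= lee_fin.
have [If _ cI] := dominated_convergence measurableT mE mEf cE gi bE.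
apply: fine_cvg; rewrite fineK//.
exact: integrable_fin_num.
Qed.

Lemma Rintegral_sum_seq d (U : measurableType d) (P : probability U R)
    (I : Type) (s : seq I) (F : I -> U -> R) :
  (forall i, P.-integrable setT (fun w => (F i w)%:E)) ->
  P.-integrable setT (fun w => (\sum_(i <- s) F i w)%:E) /\
  \int[P]_w (\sum_(i <- s) F i w) = \sum_(i <- s) \int[P]_w F i w.
Proof.
move=> iF; elim: s => [|i s [IHi IH]].
  split; last first.
    rewrite big_nil -[RHS](Rintegral_probability_cst P).
    by apply: eq_Rintegral => w _; rewrite big_nil.
  apply: (eq_integrable measurableT (EFin \o cst 0)).
    by move=> w _; rewrite /= big_nil.
  exact: (finite_measure_integrable_cst P).
split.
  apply: (eq_integrable measurableT (fun w => ((F i w)%:E + (\sum_(i <- s) F i w)%:E)%E)).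
    by move=> w _; rewrite big_cons.
  exact: (integrableD measurableT (iF i) IHi).
rewrite big_cons -IH -(RintegralD measurableT (iF i) IHi).
by apply: eq_Rintegral => w _; rewrite big_cons.
Qed.

End ProductIntegration.

(** * Uniqueness of weighted Fourier transforms, tested on half-lines *)

Section FourierUniqueness.
Context {R : realType}.
Local Notation leb := (@lebesgue_measure R).
Local Notation gauss := (normal_prob (0 : R) 1).

Section KernelRepresentation.
Context d (T : measurableType d) (P : probability T R) (V X : T -> R) (C : R).
Hypotheses (mV : measurable_fun setT V) (mX : measurable_fun setT X).
Hypothesis VC : forall w, `|V w| <= C.

(* The Gaussian kernel is itself a Fourier transform, by [gauss_cos]. *)
Lemma cos_kernel (s c : R) : 0 < s ->
  \int[P]_w (V w * normal_pdf (X w) s c) =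
  \int[gauss]_y (normal_peak s * \int[P]_w (V w * cos (y / s * X w + (- (y / s * c))))).
Proof.
move=> s0.
pose f (z : T * R) := V z.1 * (normal_peak s * cos (z.2 / s * X z.1 + (- (z.2 / s * c)))).
have m1 : measurable_fun setT (fun z : T * R => z.1) by exact: measurable_fst.
have m2 : measurable_fun setT (fun z : T * R => z.2) by exact: measurable_snd.
have mV1 : measurable_fun setT (fun z : T * R => V z.1) by exact: measurableT_comp.
have mX1 : measurable_fun setT (fun z : T * R => X z.1) by exact: measurableT_comp.
have m2s : measurable_fun setT (fun z : T * R => z.2 / s) by exact: measurable_funM.
have mf : measurable_fun setT f.
  apply: measurable_funM => //; apply: measurable_funM => //.
  apply: measurableT_comp.
    by apply: continuous_measurable_fun; exact: continuous_cos.
  apply: measurable_funD; first exact: measurable_funM.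
  by apply: measurableT_comp => //; exact: measurable_funM.
have fC z : `|f z| <= C * normal_peak s.
  rewrite /f normrM ler_pM// normrM (ger0_norm (normal_peak_ge0 _)).
  by rewrite ler_piMr ?normal_peak_ge0// ler_norml cos_geN1 cos_le1.
have iV y : P.-integrable setT (fun w => (V w * cos (y / s * X w + (- (y / s * c))))%:E).
  apply: (@bounded_integrable _ _ _ P (fun w => V w * cos (y / s * X w + (- (y / s * c)))) C).
    apply: measurable_funM => //; apply: measurableT_comp.
      by apply: continuous_measurable_fun; exact: continuous_cos.
    by apply: measurable_funD => //; exact: measurable_funM.
  move=> w; rewrite normrM (le_trans _ (VC w))// ler_piMr//.
  by rewrite ler_norml cos_geN1 cos_le1.
transitivity (\int[P]_w \int[gauss]_y f (w, y)).
  apply: eq_Rintegral => w _; rewrite /f/=.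
  rewrite normal_pdfE ?gt_eqF// /normal_fun.
  pose t := (X w - c) / s.
  have -> : expR (- (c - X w) ^+ 2 / (s ^+ 2 *+ 2)) = \int[gauss]_y cos (t * y).
    by rewrite gauss_cos /t; congr expR; field; rewrite gt_eqF.
  have ic : gauss.-integrable setT (EFin \o (fun y : R => cos (t * y))).
    apply: (@bounded_integrable _ _ _ gauss _ 1) => [|y]; last by rewrite ler_norml cos_geN1 cos_le1.
    by have := measurable_cosM t 0; under eq_fun do rewrite addr0.
  rewrite mulrA -(RintegralZl _ measurableT ic); apply: eq_Rintegral => y _.
  rewrite mulrA; congr (_ * cos _); rewrite /t; field; rewrite gt_eqF//.
rewrite (bounded_fubini P gauss mf fC); apply: eq_Rintegral => y _.
rewrite -(RintegralZl _ measurableT (iV y)); apply: eq_Rintegral => w _.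
by rewrite /f/=; ring.
Qed.

(** For fixed [w] the noisy value [X w + s * y] is normal with mean [X w] and scale [s], so
    averaging the indicator over the noise integrates the kernel over the half-line. Fubini then
    leaves, for each [c], exactly the kernel average that [cos_kernel] expresses through cosines. *)
Lemma gauss_smoothing (s a : R) : 0 < s ->
  \int[P]_w (V w * \int[gauss]_y (a <= X w + s * y)%R%:R) =
  \int[leb]_c ((a <= c)%R%:R * \int[P]_w (V w * normal_pdf (X w) s c)).
Proof.
move=> s0.
have sn0 : s != 0 by rewrite gt_eqF.
have C0 : 0 <= C by apply: le_trans (VC point).
pose g (c : R) : R := (a <= c)%R%:R.
have mg : measurable_fun setT g.
  by apply: measurable_geT_indic.
have g1 c : `|g c| <= 1 by rewrite /g; case: (a <= c); rewrite ?normr1 ?normr0 ?ler01.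
have ipdf x : leb.-integrable setT (fun c => (g c * normal_pdf x s c)%:E).
  apply: integrable_normalP => //.
  exact: (@bounded_integrable _ _ _ (normal_prob x s) g 1).
have Qx x : \int[gauss]_y g (x + s * y) = \int[leb]_c (g c * normal_pdf x s c).
  have mxs : measurable_fun setT (fun y : R => x + s * y).
    by apply: measurable_funD => //; exact: measurable_funM.
  have ig : gauss.-integrable setT (fun y => (g (x + s * y))%:E).
    apply: (@bounded_integrable _ _ _ gauss (fun y => g (x + s * y)) 1) => //.
    exact: measurableT_comp.
  have ig' := @bounded_integrable _ _ _ (normal_prob x s) g 1 mg g1.
  rewrite -(Rintegral_normal mg ig').
  have mid : measurable_fun setT (fun y : R => y) by [].
  have [_ ->] := eq_law_integral (m1 := normal_prob x s) (m2 := gauss)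
    mid mxs mg (fun B mB => normal_prob_affine x s0 mB) ig.
  by [].
pose f (z : T * R) := V z.1 * (g z.2 * normal_pdf (X z.1) s z.2).
have m1 : measurable_fun setT (fun z : T * R => z.1) by exact: measurable_fst.
have m2 : measurable_fun setT (fun z : T * R => z.2) by exact: measurable_snd.
have mf : measurable_fun setT f.
  apply: measurable_funM; first exact: measurableT_comp.
  apply: measurable_funM; first exact: measurableT_comp.
  under eq_fun do rewrite normal_pdfE//.
  apply: measurable_funM => //; apply: measurableT_comp => //.
  apply: measurable_funM => //; apply: measurableT_comp => //.
  apply: measurable_funX; apply: measurable_funB => //.
  exact: measurableT_comp.
have fw w : leb.-integrable setT (fun c => (f (w, c))%:E).
  exact: (integrableZl measurableT (V w) (ipdf (X w))).
(* Lebesgue measure is infinite, so boundedness is not enough here: the kernel has integral [1] in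
   [c], which bounds the iterated integral by [C]. *)
have fi : (P \x leb)%E.-integrable setT (EFin \o f).
  apply/integrable12ltyP; first exact/measurable_EFinP.
  apply: (@le_lt_trans _ _ (\int[P]_w C%:E)%E).
    apply: ge0_le_integral => //=.
    - move=> w _; apply: integral_ge0 => y _; rewrite lee_fin//.
    - have mabs : measurable_fun setT (fun z : T * R => `|f z|%:E).
        by apply/measurable_EFinP; exact: measurableT_comp.
      have f0 (z : T * R) : (0 <= `|f z|%:E)%E by rewrite lee_fin.
      exact: (@measurable_fun_fubini_tonelli_F _ _ _ _ _ leb _ mabs f0).
    move=> w _; apply: (@le_trans _ _ (\int[leb]_y (C * normal_pdf (X w) s y)%:E)%E).
      apply: ge0_le_integral => //=.
      - apply/measurable_EFinP; apply: measurableT_comp => //.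
        exact: (measurableT_comp mf (measurable_pair1 w)).
      - apply/measurable_EFinP; apply: measurable_funM => //.
        exact: measurable_normal_pdf.
      move=> y _; rewrite lee_fin /f/= normrM ler_pM// normrM.
      rewrite (ger0_norm (normal_pdf_ge0 _ _ _)) ler_piMl ?normal_pdf_ge0//.
    under eq_integral do rewrite EFinM.
    rewrite ge0_integralZl//; last 2 first.
    - by apply/measurable_EFinP; exact: measurable_normal_pdf.
    - by move=> x _; rewrite lee_fin normal_pdf_ge0.
    by rewrite integral_normal_pdf mule1.
  rewrite integral_cst// ltey_eq fin_numM//.
  exact: fin_num_measure.
transitivity (\int[P]_w \int[leb]_c f (w, c)).
  apply: eq_Rintegral => w _; rewrite Qx -(RintegralZl _ measurableT (ipdf (X w))).
  by [].
rewrite (Rintegral_fubini fi fw); last first.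
  move=> c; apply: (@bounded_integrable _ _ _ P (fun w => f (w, c)) (C * normal_peak s)).
    exact: (measurableT_comp mf (measurable_pair2 c)).
  move=> w; rewrite /f/= normrM ler_pM// normrM (ger0_norm (normal_pdf_ge0 _ _ _)).
  by rewrite -[leRHS]mul1r ler_pM// ?normal_pdf_ge0// normal_pdf_ub.
apply: eq_Rintegral => c _; rewrite -RintegralZl//; last first.
  apply: (@bounded_integrable _ _ _ P (fun w => V w * normal_pdf (X w) s c) (C * normal_peak s)).
    apply: measurable_funM => //; under eq_fun do rewrite normal_pdfE//.
    apply: measurable_funM => //; apply: measurableT_comp => //.
    apply: measurable_funM => //; apply: measurableT_comp => //.
    by apply: measurable_funX; apply: measurable_funB.
  by move=> w; rewrite normrM ler_pM// ger0_norm ?normal_pdf_ge0// normal_pdf_ub.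
by apply: eq_Rintegral => w _; rewrite /f/=/g; ring.
Qed.

(* The noise [n^-2 * y] is negligible with respect to the shift [n^-1], so that the
   limit is the indicator of the closed half-line. *)
Lemma cvg_smoothing (a : R) :
  \int[P]_w (V w * \int[gauss]_y (a - n.+1%:R^-1 <= X w + n.+1%:R ^- 2 * y)%R%:R)
    @[n --> \oo] --> \int[P]_w (V w * (a <= X w)%R%:R).
Proof.
pose g n (x y : R) : R := (a - n.+1%:R^-1 <= x + n.+1%:R ^- 2 * y)%R%:R.
have g01 n x y : `|g n x y| <= 1.
  by rewrite /g normr_nat lern1 leq_b1.
have mg n x : measurable_fun setT (g n x).
  apply: measurable_geT_indic.
  by apply: measurable_funD => //; exact: measurable_funM.
have i1 : gauss.-integrable setT (EFin \o cst (1 : R)).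
  by apply: (finite_measure_integrable_cst gauss).
have large (z : R) : \forall n \near \oo, z < n.+1%:R.
  exists (Num.truncn `|z|).+1 => // n /= zn.
  rewrite (le_lt_trans (ler_norm _))// (lt_le_trans (truncnS_gt _))//.
  by rewrite ler_nat (leq_trans zn).
have pw x y : g n x y @[n --> \oo] --> ((a <= x)%R%:R : R).
  apply: cvg_near_cst.
  (* For fixed [x] and [y] the sequence is eventually constant. If [a <= x], the noise is eventually
     dominated by the shift; otherwise shift and noise together eventually stay below the gap
     [a - x]. *)
  have [ax|xa] := leP a x.
    near=> n; rewrite /g (_ : (_ <= _)%R = true)//; apply: (introT idP).
    have n0 : 0 < (n.+1%:R : R) by [].
    have yn : - y < n.+1%:R by near: n; exact: large.
    rewrite -exprVn expr2.
    have : n.+1%:R^-1 * (n.+1%:R^-1 * - y) <= n.+1%:R^-1 * 1 :> R.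
      by rewrite ler_wpM2l ?invr_ge0// mulrC ler_pdivrMr// mul1r ltW.
    rewrite mulr1 mulrN mulrN mulrA.
    by set z := (n.+1%:R^-1 / n.+1%:R * y); move: z (n.+1%:R^-1) => z k; lra.
  near=> n; rewrite /g (_ : (_ <= _)%R = false)//.
  apply/negbTE; rewrite -ltNge.
  have n0 : 0 < (n.+1%:R : R) by [].
  have ax0 : 0 < a - x by rewrite subr_gt0.
  have yn : (1 + `|y|) / (a - x) < n.+1%:R by near: n; exact: large.
  rewrite ltr_pdivrMr// -ltr_pdivrMl// in yn.
  rewrite -exprVn expr2.
  have h1 : n.+1%:R^-1 * y <= `|y|.
    rewrite (le_trans (ler_norm _))// normrM ger0_norm ?invr_ge0// ler_piMl//.
    by rewrite invf_le1// ler1n.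
  have : n.+1%:R^-1 * (n.+1%:R^-1 * y) <= n.+1%:R^-1 * `|y| :> R.
    by rewrite ler_wpM2l ?invr_ge0.
  move: yn; rewrite mulrDr mulr1 mulrA.
  set z := (n.+1%:R^-1 / n.+1%:R * y); set k := n.+1%:R^-1 * `|y|.
  by move: z k (n.+1%:R^-1) => z k' k; lra.
have pw2 x : \int[gauss]_y g n x y @[n --> \oo] --> ((a <= x)%R%:R : R).
  rewrite -[X in _ --> X](Rintegral_probability_cst gauss).
  exact: (@Rintegral_dominated_cvg _ _ _ gauss (fun n => g n x)
    (cst ((a <= x)%R%:R)) (cst 1) (fun n => mg n x) (measurable_cst _) i1
    (fun n y => g01 n x y) (fun y => pw x y)).
have I01 n x : `|\int[gauss]_y g n x y| <= 1.
  rewrite -[leRHS](Rintegral_probability_cst gauss).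
  have ign : gauss.-integrable setT (EFin \o g n x).
    exact: (@bounded_integrable _ _ _ gauss (g n x) 1 (mg n x) (g01 n x)).
  apply: (le_trans (le_normr_Rintegral measurableT ign)).
  by apply: le_Rintegral => //; exact: (integrable_norm ign).
have mI n : measurable_fun setT (fun w => \int[gauss]_y g n (X w) y).
  pose G (z : T * R) := g n (X z.1) z.2.
  have mG : measurable_fun setT (fun z => (G z)%:E).
    apply/measurable_EFinP; apply: measurable_geT_indic.
    apply: measurable_funD; first exact: measurableT_comp.
    by apply: measurable_funM.
  have G0 z : (0 <= (G z)%:E)%E by rewrite lee_fin /G /g.
  have := @measurable_fun_fubini_tonelli_F _ _ _ _ _ gauss _ mG G0.
  by move=> mF; exact: (measurableT_comp (fine_measurable measurableT) mF).
have iC : P.-integrable setT (EFin \o cst C) by exact: (finite_measure_integrable_cst P).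
have mf_ n := measurable_funM mV (mI n).
have mf := measurable_funM mV (measurable_geT_indic a mX).
have b_ n w : `|V w * \int[gauss]_y g n (X w) y| <= C.
  by rewrite normrM -[leRHS]mulr1 ler_pM.
have c_ w : V w * \int[gauss]_y g n (X w) y @[n --> \oo] --> V w * (a <= X w)%R%:R.
  by apply: cvgMr; exact: pw2.
exact: (@Rintegral_dominated_cvg _ _ _ P _ _ (cst C) mf_ mf iC b_ c_).
Unshelve. all: by end_near. Qed.

End KernelRepresentation.

(** After smoothing, both sides depend on the data only through weighted cosine integrals, and the
    smoothing is then removed in the limit. The weights carry the rest of a joint law: taking for
    [V1] and [V2] functions of other variables turns this one-dimensional uniqueness into a
    statement about several variables. *)
Lemma fourier_ge d1 d2 (T1 : measurableType d1) (T2 : measurableType d2)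
    (P1 : probability T1 R) (P2 : probability T2 R)
    (V1 X1 : T1 -> R) (V2 X2 : T2 -> R) (C1 C2 : R) :
  measurable_fun setT V1 -> measurable_fun setT X1 -> (forall w, `|V1 w| <= C1) ->
  measurable_fun setT V2 -> measurable_fun setT X2 -> (forall w, `|V2 w| <= C2) ->
  (forall t u, \int[P1]_w (V1 w * cos (t * X1 w + u)) =
               \int[P2]_w (V2 w * cos (t * X2 w + u))) ->
  forall a, \int[P1]_w (V1 w * (a <= X1 w)%R%:R) =
            \int[P2]_w (V2 w * (a <= X2 w)%R%:R).
Proof.
move=> mV1 mX1 b1 mV2 mX2 b2 E a.
have l1 := cvg_smoothing (P := P1) mV1 mX1 b1 (a := a).
have l2 := cvg_smoothing (P := P2) mV2 mX2 b2 (a := a).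
suff EE : (fun n => \int[P1]_w (V1 w *
      \int[gauss]_y (a - n.+1%:R^-1 <= X1 w + n.+1%:R ^- 2 * y)%R%:R)) =
    (fun n => \int[P2]_w (V2 w *
      \int[gauss]_y (a - n.+1%:R^-1 <= X2 w + n.+1%:R ^- 2 * y)%R%:R)).
  by rewrite EE in l1; exact: (cvg_unique _ l1 l2).
apply/funext => n.
have s0 : 0 < (n.+1%:R ^- 2 : R) by rewrite invr_gt0 exprn_gt0.
rewrite (gauss_smoothing P1 mV1 mX1 b1)// (gauss_smoothing P2 mV2 mX2 b2)//.
apply: eq_Rintegral => c _; congr (_ * _).
rewrite (cos_kernel P1 mV1 mX1 b1)// (cos_kernel P2 mV2 mX2 b2)//.
by apply: eq_Rintegral => y _; rewrite E.
Qed.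

End FourierUniqueness.

(** * From linear forms to joint laws of finitely many coordinates *)

Section FiniteFamilies.
Context {R : realType}.
Context d1 d2 (T1 : measurableType d1) (T2 : measurableType d2).
Context (P1 : probability T1 R) (P2 : probability T2 R).

Lemma measurable_cos_comp d (T : measurableType d) (U : T -> R) :
  measurable_fun setT U -> measurable_fun setT (fun w => cos (U w)).
Proof.
move=> mU; apply: measurableT_comp => //.
by apply: continuous_measurable_fun; exact: continuous_cos.
Qed.

Lemma cos_le1N (x : R) : `|cos x| <= 1.
Proof. by rewrite ler_norml cos_geN1 cos_le1. Qed.

Lemma cosM_cos (x y : R) : cos x * cos y = (cos (x + y) + cos (x - y)) / 2.
Proof. by rewrite cosD cosB; field. Qed.

Lemma measurable_linear_sum (I : Type) d (T : measurableType d) (s : seq I)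
    (X : I -> T -> R) (t : I -> R) : (forall i, measurable_fun setT (X i)) ->
  measurable_fun setT (fun w => \sum_(i <- s) t i * X i w).
Proof.
move=> mX; apply: measurable_sum => i; exact: measurable_funM.
Qed.

(* The coordinates are converted one at a time: those already converted enter the
   weights [W1] and [W2] through indicators. *)
Lemma cramer_wold (I : eqType) (s : seq I) (X1 : I -> T1 -> R) (X2 : I -> T2 -> R)
    (W1 : T1 -> R) (W2 : T2 -> R) (C : R) :
  uniq s ->
  (forall i, measurable_fun setT (X1 i)) -> (forall i, measurable_fun setT (X2 i)) ->
  measurable_fun setT W1 -> (forall w, `|W1 w| <= C) ->
  measurable_fun setT W2 -> (forall w, `|W2 w| <= C) ->
  (forall t u, \int[P1]_w (W1 w * cos (\sum_(i <- s) t i * X1 i w + u)) =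
               \int[P2]_w (W2 w * cos (\sum_(i <- s) t i * X2 i w + u))) ->
  forall (a : I -> R) (b : I -> bool),
    \int[P1]_w (W1 w * \prod_(i <- s) ((a i <= X1 i w)%R == b i)%:R) =
    \int[P2]_w (W2 w * \prod_(i <- s) ((a i <= X2 i w)%R == b i)%:R).
Proof.
move=> us mX1 mX2 mW1 b1 mW2 b2 E a b.
elim: s us W1 W2 mW1 b1 mW2 b2 E => [_|i s IH /= /andP[ins us]] W1 W2 mW1 b1 mW2 b2 E.
  have := E (fun=> 0) 0; under eq_Rintegral do rewrite big_nil addr0 cos0.
  under [in RHS]eq_Rintegral do rewrite big_nil addr0 cos0.
  move=> e; under eq_Rintegral do rewrite big_nil.
  by under [in RHS]eq_Rintegral do rewrite big_nil.
under eq_Rintegral do rewrite big_cons mulrA.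
under [in RHS]eq_Rintegral do rewrite big_cons mulrA.
have ind1 (b0 : bool) : `|b0%:R : R| <= 1 by rewrite normr_nat lern1 leq_b1.
have m_ind1 := measurable_ge_indic (a i) (b i) (mX1 i).
have m_ind2 := measurable_ge_indic (a i) (b i) (mX2 i).
apply: IH => //.
- exact: measurable_funM.
- by move=> w; rewrite normrM (le_trans _ (b1 w))// ler_piMr.
- exact: measurable_funM.
- by move=> w; rewrite normrM (le_trans _ (b2 w))// ler_piMr.
move=> t u.
pose Y1 w := \sum_(j <- s) t j * X1 j w + u.
pose Y2 w := \sum_(j <- s) t j * X2 j w + u.
have mY1 : measurable_fun setT Y1.
  by apply: measurable_funD => //; exact: measurable_linear_sum.
have mY2 : measurable_fun setT Y2.
  by apply: measurable_funD => //; exact: measurable_linear_sum.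
pose V1 w := W1 w * cos (Y1 w).
pose V2 w := W2 w * cos (Y2 w).
have mV1 : measurable_fun setT V1 by apply: measurable_funM => //; exact: measurable_cos_comp.
have mV2 : measurable_fun setT V2 by apply: measurable_funM => //; exact: measurable_cos_comp.
have bV1 w : `|V1 w| <= C by rewrite normrM (le_trans _ (b1 w))// ler_piMr// cos_le1N.
have bV2 w : `|V2 w| <= C by rewrite normrM (le_trans _ (b2 w))// ler_piMr// cos_le1N.
(* The hypothesis knows a single cosine of a linear form in all coordinates, whereas the new weight
   [V1] already contains a cosine. The product of the two is split into cosines of a sum and of a
   difference. *)
have split d (T : measurableType d) (P : probability T R) (W Y X : T -> R) (t' u' : R) :
    measurable_fun setT W -> measurable_fun setT Y -> measurable_fun setT X ->
    (forall w, `|W w| <= C) ->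
    \int[P]_w (W w * cos (Y w) * cos (t' * X w + u')) =
    (\int[P]_w (W w * cos (t' * X w + Y w + u')) +
     \int[P]_w (W w * cos (- t' * X w + Y w - u'))) / 2.
  move=> mW mY mX bW.
  have int_cos (Z : T -> R) : measurable_fun setT Z ->
      P.-integrable setT (EFin \o (fun w => W w * cos (Z w))).
    move=> mZ; apply: (@bounded_integrable _ _ _ P (fun w => W w * cos (Z w)) C).
      by apply: measurable_funM => //; exact: measurable_cos_comp.
    by move=> w; rewrite normrM (le_trans _ (bW w))// ler_piMr// cos_le1N.
  have m1 : measurable_fun setT (fun w => t' * X w + Y w + u').
    by apply: measurable_funD => //; apply: measurable_funD => //; exact: measurable_funM.
  have m2 : measurable_fun setT (fun w => - t' * X w + Y w - u').
    by apply: measurable_funB => //; apply: measurable_funD => //; exact: measurable_funM.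
  rewrite -RintegralD//; [|exact: (int_cos _ m1)|exact: (int_cos _ m2)].
  have int_sum := integrableD measurableT (int_cos _ m1) (int_cos _ m2).
  rewrite -(RintegralZr _ measurableT int_sum); apply: eq_Rintegral => w _.
  rewrite -mulrA cosM_cos -mulrDr mulrA; congr (_ * (cos _ + cos _) / _); ring.
have EV t' u' : \int[P1]_w (V1 w * cos (t' * X1 i w + u')) =
                \int[P2]_w (V2 w * cos (t' * X2 i w + u')).
  rewrite /V1 /V2 !split//.
  have EE v u0 : \int[P1]_w (W1 w * cos (v * X1 i w + Y1 w + u0)) =
              \int[P2]_w (W2 w * cos (v * X2 i w + Y2 w + u0)).
    (* The coordinate [i] does not occur in the tail [s], so its coefficient can be set to [v]
       without disturbing the other terms. *)
    have sumE (T : Type) (X : I -> T -> R) w : v * X i w + (\sum_(j <- s) t j * X j w + u) + u0 =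
       \sum_(j <- i :: s) (if j == i then v else t j) * X j w + (u + u0).
      rewrite big_cons eqxx !addrA; congr (_ + _ + _ + _).
      apply: eq_big_seq => j js.
      by case: eqP => // ji; move: ins; rewrite -ji js.
    transitivity (\int[P1]_w (W1 w *
        cos (\sum_(j <- i :: s) (if j == i then v else t j) * X1 j w + (u + u0)))).
      by apply: eq_Rintegral => w _; rewrite sumE.
    by rewrite E; apply: eq_Rintegral => w _; rewrite sumE.
  by rewrite !EE.
have F := fourier_ge mV1 (mX1 i) bV1 mV2 (mX2 i) bV2 EV (a i).
have E0 : \int[P1]_w V1 w = \int[P2]_w V2 w.
  transitivity (\int[P1]_w (V1 w * cos (0 * X1 i w + 0))).
    by apply: eq_Rintegral => w _; rewrite mul0r add0r cos0 mulr1.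
  by rewrite EV; apply: eq_Rintegral => w _; rewrite mul0r add0r cos0 mulr1.
transitivity (\int[P1]_w (V1 w * ((a i <= X1 i w)%R == b i)%:R)).
  by apply: eq_Rintegral => w _; rewrite mulrAC.
transitivity (\int[P2]_w (V2 w * ((a i <= X2 i w)%R == b i)%:R)); last first.
  by apply: eq_Rintegral => w _; rewrite mulrAC.
case: (b i).
  transitivity (\int[P1]_w (V1 w * (a i <= X1 i w)%R%:R)).
    by apply: eq_Rintegral => w _; rewrite eqb_id.
  by rewrite F; apply: eq_Rintegral => w _; rewrite eqb_id.
have compl d (T : measurableType d) (P : probability T R) (V X : T -> R) :
    measurable_fun setT V -> measurable_fun setT X -> (forall w, `|V w| <= C) ->
    \int[P]_w (V w * ((a i <= X w)%R == false)%:R) =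
    \int[P]_w V w - \int[P]_w (V w * (a i <= X w)%R%:R).
  move=> mV mX bV; rewrite -RintegralB//.
  - apply: eq_Rintegral => w _; rewrite eqbF_neg.
    by case: (_ <= _)%R; rewrite /= ?mulr1 ?mulr0 ?subrr ?subr0.
  - exact: (@bounded_integrable _ _ _ P V C).
  - apply: (@bounded_integrable _ _ _ P (fun w => V w * (a i <= X w)%R%:R) C).
      by apply: measurable_funM => //; exact: measurable_geT_indic.
    by move=> w; rewrite normrM (le_trans _ (bV w))// ler_piMr.
by rewrite !compl// E0 F.
Qed.

End FiniteFamilies.

(** * Moments and characteristic functions of linear forms of the field *)

Section GaussianFieldTheory.
Context {R : realType} {T : choiceType}.
Local Notation gauss := (normal_prob (0 : R) 1).
Context (P : probability (field_space R T) R) (g : T -> T -> \bar R).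
Hypothesis Hg : centered_gaussian_field P g.

Lemma measurable_coord (x : T) :
  measurable_fun setT (fun phi : field_space R T => phi x : R).
Proof.
move=> _ B mB; rewrite setTI; apply: sub_sigma_algebra.
by exists x, B.
Qed.

Definition linear_form (s : seq T) (a : T -> R) (phi : field_space R T) : R :=
  \sum_(x <- s) a x * phi x.

Lemma measurable_linear_form s a : measurable_fun setT (linear_form s a).
Proof.
apply: measurable_sum => x; apply: measurable_funM => //.
exact: measurable_coord.
Qed.

Lemma linear_form_law s a : exists m v : R, 0 <= v /\
  forall f : R -> R, measurable_fun setT f ->
    gauss.-integrable setT (fun x => (f (m + v * x))%:E) ->
    P.-integrable setT (fun w => (f (linear_form s a w))%:E) /\
    \int[P]_w f (linear_form s a w) = \int[gauss]_x f (m + v * x).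
Proof.
case: Hg => law _ _; apply: Rintegral_gaussian_law; last exact: law.
exact: measurable_linear_form.
Qed.

Lemma integrable_gauss_affine (m v : R) :
  gauss.-integrable setT (fun x => (m + v * x)%:E).
Proof.
apply: (@integrable_gauss_exp _ (fun x => m + v * x) (`|m| + `|v|) 1).
  by apply: measurable_funD => //; exact: measurable_funM.
move=> x; rewrite (mul1r `|x|) (le_trans (ler_normD _ _))// mulrDl lerD//.
  by rewrite ler_peMr// -expR0 ler_expR.
by rewrite normrM ler_wpM2l//; have := id_le_exp x; rewrite mul1r.
Qed.

Lemma gauss_affine_mean (m v : R) : \int[gauss]_x (m + v * x) = m.
Proof.
have iv : gauss.-integrable setT (fun x => (v * x)%:E).
  exact: (integrableZl measurableT v (@integrable_gauss_id R)).
have im : gauss.-integrable setT (EFin \o cst m).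
  by apply: (finite_measure_integrable_cst gauss).
rewrite (RintegralD measurableT im iv) Rintegral_probability_cst.
by rewrite (RintegralZl _ measurableT (@integrable_gauss_id R)) gauss_mean mulr0 addr0.
Qed.

Lemma integrable_gauss_sqr (v : R) :
  gauss.-integrable setT (fun x => (v * x * (v * x))%:E).
Proof.
apply: (@integrable_gauss_exp _ (fun x => v * x * (v * x)) (`|v| ^+ 2) 2).
  by apply: measurable_funM => //; exact: measurable_funM.
move=> x; rewrite !normrM mulrACA -expr2 ler_wpM2l ?sqr_ge0// mulrDl mul1r expRD.
by have := id_le_exp x; rewrite mul1r => h; rewrite ler_pM.
Qed.

Lemma gauss_sqr_scaled (v : R) : \int[gauss]_x (v * x * (v * x)) = v ^+ 2.
Proof.
have i1 : gauss.-integrable setT (fun x => (x * x : R)%:E).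
  have := integrable_gauss_sqr 1; apply: eq_integrable => // x _.
  by rewrite mul1r.
transitivity (\int[gauss]_x (v ^+ 2 * (x * x))).
  by apply: eq_Rintegral => x _; rewrite mulrACA expr2.
by rewrite (RintegralZl _ measurableT i1) gauss_sqr_mean mulr1.
Qed.

Let single x (w : field_space R T) : linear_form [:: x] (fun=> 1) w = w x.
Proof. by rewrite /linear_form big_seq1 mul1r. Qed.

Lemma integrable_coord x : P.-integrable setT (fun phi => (phi x)%:E).
Proof.
have [m [v [_ H]]] := linear_form_law [:: x] (fun=> 1).
have [//|+ _] := H (fun x => x) _ (integrable_gauss_affine m v).
by apply: eq_integrable => // w _; rewrite single.
Qed.

Lemma coord_mean x : \int[P]_phi (phi x) = 0.
Proof.
case: Hg => _ E0 _; have := E0 x; rewrite unlock => E.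
by rewrite /Rintegral E.
Qed.

(** Square integrability of the coordinates must be known before [cov] can be identified with the
    given covariance; removing the mean of one coordinate is enough for that. *)
Lemma coord_centered_law x : exists v : R, forall f : R -> R, measurable_fun setT f ->
    gauss.-integrable setT (fun x => (f (v * x))%:E) ->
    P.-integrable setT (fun w => (f (w x))%:E).
Proof.
have [m [v [_ H]]] := linear_form_law [:: x] (fun=> 1).
have m0 : m = 0.
  have [//|_ e] := H (fun x => x) _ (integrable_gauss_affine m v).
  rewrite gauss_affine_mean in e; rewrite -e -(coord_mean x).
  by apply: eq_Rintegral => w _; rewrite single.
exists v => f mf fi; have [|+ _] := H f mf _.
  by apply: eq_integrable fi => // y _; rewrite m0 add0r.
by apply: eq_integrable => // w _; rewrite single.
Qed.

Lemma integrable_coordM x y : P.-integrable setT (fun phi => (phi x * phi y)%:E).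
Proof.
have sq z : P.-integrable setT (fun phi => (phi z * phi z)%:E).
  have [v H] := coord_centered_law z; apply: (H (fun x => x * x)).
    exact: measurable_funM.
  exact: integrable_gauss_sqr.
have mc := measurable_coord.
apply: (@le_integrable _ _ _ P _ measurableT _ (fun phi => (phi x * phi x + phi y * phi y)%:E)).
- by apply/measurable_EFinP; apply: measurable_funM.
- move=> w _; rewrite lee_fin (ger0_norm (addr_ge0 _ _)) -?expr2 ?sqr_ge0//.
  rewrite ler_norml; apply/andP; split.
    have := sqr_ge0 (w x + w y); have := sqr_ge0 (w x); have := sqr_ge0 (w y).
    by rewrite !expr2; nra.
  have := sqr_ge0 (w x - w y); have := sqr_ge0 (w x); have := sqr_ge0 (w y).
  by rewrite !expr2; nra.
- by have := integrableD measurableT (sq x) (sq y).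
Qed.

Definition cov (x y : T) : R := \int[P]_phi (phi x * phi y).

(** Besides identifying the covariance, this shows that [g] is finite, which its type does not say.
    For the Green function, finiteness is what later feeds Borel-Cantelli. *)
Lemma covE x y : g x y = (cov x y)%:E.
Proof.
case: Hg => _ E0 <-; rewrite !unlock.
have := E0 x; rewrite unlock => ->; have := E0 y; rewrite unlock => ->.
rewrite /cov /Rintegral fineK; last exact: integrable_fin_num (integrable_coordM x y).
apply: eq_integral => w _; congr EFin.
by transitivity ((w x - 0) * (w y - 0)); last rewrite !subr0.
Qed.

Lemma covC x y : cov x y = cov y x.
Proof. by apply: eq_Rintegral => w _; rewrite mulrC. Qed.

Definition cov_form (s : seq T) (a c : T -> R) : R :=
  \sum_(x <- s) \sum_(y <- s) a x * c y * cov x y.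

Lemma linear_form_mean s a : \int[P]_w linear_form s a w = 0.
Proof.
have i1 x : P.-integrable setT (fun w => (a x * w x)%:E).
  exact: (integrableZl measurableT (a x) (integrable_coord x)).
have [_ ->] := Rintegral_sum_seq s i1.
rewrite big1// => x _.
by rewrite (RintegralZl _ measurableT (integrable_coord x)) coord_mean mulr0.
Qed.

Lemma linear_form_sqr_mean s a :
  \int[P]_w (linear_form s a w * linear_form s a w) = cov_form s a a.
Proof.
have i1 x y : P.-integrable setT (fun w => (a x * a y * (w x * w y))%:E).
  exact: (integrableZl measurableT (a x * a y) (integrable_coordM x y)).
have i2 x := (Rintegral_sum_seq s (i1 x)).1.
transitivity (\int[P]_w \sum_(x <- s) \sum_(y <- s) (a x * a y * (w x * w y))).
  apply: eq_Rintegral => w _; rewrite /linear_form big_distrl/=.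
  apply: eq_bigr => x _; rewrite big_distrr/=; apply: eq_bigr => y _.
  by ring.
have [_ ->] := Rintegral_sum_seq s i2.
apply: eq_bigr => x _; have [_ ->] := Rintegral_sum_seq s (i1 x).
apply: eq_bigr => y _.
by rewrite (RintegralZl _ measurableT (integrable_coordM x y)).
Qed.

(** The hypothesis provides some normal law without its parameters. Testing with the identity gives
    the mean [0], and testing with the square gives the variance. *)
Lemma linear_form_centered_law s a : exists2 v : R, v ^+ 2 = cov_form s a a &
  forall f : R -> R, measurable_fun setT f ->
    gauss.-integrable setT (fun x => (f (v * x))%:E) ->
    P.-integrable setT (fun w => (f (linear_form s a w))%:E) /\
    \int[P]_w f (linear_form s a w) = \int[gauss]_x f (v * x).
Proof.
have [m [v [_ H]]] := linear_form_law s a.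
have m0 : m = 0.
  have [//|_] := H (fun x => x) _ (integrable_gauss_affine m v).
  by rewrite gauss_affine_mean linear_form_mean.
have H' (f : R -> R) : measurable_fun setT f ->
    gauss.-integrable setT (fun x => (f (v * x))%:E) ->
    P.-integrable setT (fun w => (f (linear_form s a w))%:E) /\
    \int[P]_w f (linear_form s a w) = \int[gauss]_x f (v * x).
  move=> mf fi; have [|h1 ->] := H f mf _.
    by apply: eq_integrable fi => // y _; rewrite m0 add0r.
  by split => //; apply: eq_Rintegral => x _; rewrite m0 add0r.
exists v => //.
have msq : measurable_fun setT (fun x : R => x * x) by exact: measurable_funM.
have [_] := H' _ msq (integrable_gauss_sqr v).
by rewrite gauss_sqr_scaled linear_form_sqr_mean.
Qed.

(** Through this formula, equality of two cosine integrals of linear forms becomes an identity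
    between quadratic expressions in the coefficients. *)
Lemma linear_form_cos s a u :
  \int[P]_w cos (linear_form s a w + u) = cos u * expR (- (cov_form s a a / 2)).
Proof.
have [v vE H] := linear_form_centered_law s a.
have m1 : measurable_fun setT (fun x : R => cos (x + u)).
  by apply: measurable_cos_comp; exact: measurable_funD.
have i1 : gauss.-integrable setT (fun x => (cos (v * x + u))%:E).
  apply: (@bounded_integrable _ _ _ gauss (fun x => cos (v * x + u)) 1).
    exact: measurable_cosM.
  by move=> x; rewrite cos_le1N.
have [_ ->] := H _ m1 i1.
by rewrite gauss_cosD vE.
Qed.

End GaussianFieldTheory.

(** * Splitting the field into a normalised linear form and an independent remainder *)

Section Disintegration.
Context {R : realType} {T : choiceType}.
Local Notation gauss := (normal_prob (0 : R) 1).

(** The configuration is a predicate on all of [T], so that the field, the model [X2] and shifted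
    levels can be substituted without passing through the subtype [K]. *)
Definition excursion_indic (K : {fset T}) (A : {set {ffun K -> bool}})
  (chi : T -> bool) : R := ([ffun z : K => chi (val z)] \in A)%:R.

Let extend (K : {fset T}) (w : {ffun K -> bool}) (y : T) : bool :=
  oapp w false (insub y).

(** The product for [w] vanishes unless the configuration on [K] is [w], so at most one term
    survives. This writes an arbitrary event as a finite sum of the products handled by
    [cramer_wold]. *)
Lemma excursion_indicE (K : {fset T}) (A : {set {ffun K -> bool}}) (chi : T -> bool) :
  excursion_indic A chi =
  \sum_(w in A) \prod_(y <- enum_fset K) (chi y == extend w y)%:R.
Proof.
have prodE (w : {ffun K -> bool}) :
    \prod_(y <- enum_fset K) ((chi y == extend w y)%:R : R) =
    ([ffun z : K => chi (val z)] == w)%:R.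
  case: eqP => [e|ne].
    rewrite big_seq big1// => y yK; rewrite -e /extend insubT/= ffunE eqxx//.
  have /existsP[z zP] : [exists z : K, chi (val z) != w z].
    rewrite -negb_forall; apply/negP => /forallP H; apply: ne.
    by apply/ffunP => z; rewrite ffunE; apply/eqP; exact: H.
  apply/eqP; rewrite prodf_seq_eq0; apply/hasP; exists (val z); first exact: valP.
  by rewrite /extend valK/= (negbTE zP).
under eq_bigr do rewrite prodE.
rewrite /excursion_indic; case: (boolP (_ \in A)) => [iA|nA].
  rewrite (bigD1 _ iA)/= eqxx big1 ?addr0// => w /andP[_ wn].
  by rewrite eq_sym (negbTE wn).
rewrite big1// => w wA; case: eqP => // e; move: nA; by rewrite e wA.
Qed.

Lemma measurable_excursion_indic d (U : measurableType d) (K : {fset T})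
    (A : {set {ffun K -> bool}}) (h : R) (X : T -> U -> R) :
  (forall y, measurable_fun setT (X y)) ->
  measurable_fun setT (fun u => excursion_indic A (fun y => h <= X y u)).
Proof.
move=> mX; rewrite (_ : (fun u => _) = (fun u => \sum_(w in A)
    \prod_(y <- enum_fset K) ((h <= X y u)%R == extend w y)%:R)); last first.
  by apply/funext => u; rewrite excursion_indicE.
under eq_fun do rewrite -big_enum/=.
apply: measurable_sum => w; apply: measurable_prod => y _.
exact: measurable_ge_indic.
Qed.

Lemma excursion_indic01 (K : {fset T}) (A : {set {ffun K -> bool}}) (chi : T -> bool) :
  0 <= excursion_indic A chi <= 1.
Proof. by rewrite /excursion_indic ler0n lern1 leq_b1. Qed.

Lemma le_excursion_indic (K : {fset T}) (A : {set {ffun K -> bool}}) (chi chi' : T -> bool) :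
  increasing A -> (forall y, y \in K -> chi y -> chi' y) ->
  excursion_indic A chi <= excursion_indic A chi'.
Proof.
move=> incA le_chi; rewrite /excursion_indic ler_nat.
case: (boolP (_ \in A)) => // iA; rewrite (incA _ _ iA)// => z; rewrite !ffunE.
by apply: le_chi; exact: valP.
Qed.

Lemma eq_excursion_indic (K : {fset T}) (A : {set {ffun K -> bool}}) (chi chi' : T -> bool) :
  (forall y, y \in K -> chi y = chi' y) ->
  excursion_indic A chi = excursion_indic A chi'.
Proof.
move=> eq_chi; rewrite /excursion_indic.
suff -> : [ffun z : K => chi (val z)] = [ffun z : K => chi' (val z)] by [].
by apply/ffunP => z; rewrite !ffunE; apply: eq_chi; exact: valP.
Qed.

Context (P : probability (field_space R T) R) (g : T -> T -> \bar R).
Hypothesis Hg : centered_gaussian_field P g.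
Context (K : {fset T}).
Local Notation s := (enum_fset K).
Variable a : T -> R.
Hypothesis a1 : cov_form P s a a = 1.

Let N := linear_form s a.
(** The covariance of [N] with the coordinate [y]. As [N] has variance [1] by [a1], it is also the
    regression coefficient, and [phi y - b y * N phi] is uncorrelated with [N]. *)
Let b (y : T) : R := \sum_(x <- s) a x * cov P x y.
(* When [t] is standard normal and independent of [w], the family [X2 y (t, w)] has
   the law of the field, and [t] plays the role of [N]. *)
Let X2 (y : T) (z : R * field_space R T) : R := b y * z.1 + (z.2 y - b y * N z.2).

Let mN : measurable_fun setT N.
Proof. exact: measurable_linear_form. Qed.

Let mX2 y : measurable_fun setT (X2 y).
Proof.
have m1 : measurable_fun setT (fun z : R * field_space R T => z.1) by exact: measurable_fst.
have m2 : measurable_fun setT (fun z : R * field_space R T => z.2) by exact: measurable_snd.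
apply: measurable_funD; first exact: measurable_funM.
apply: measurable_funB.
  exact: (measurableT_comp (measurable_coord (R := R) y) m2).
by apply: measurable_funM => //; exact: (measurableT_comp mN m2).
Qed.

Lemma cov_formDl (c c' e : T -> R) :
  cov_form P s (fun x => c x + c' x) e = cov_form P s c e + cov_form P s c' e.
Proof.
rewrite /cov_form -big_split/=; apply: eq_bigr => x _.
by rewrite -big_split/=; apply: eq_bigr => y _; ring.
Qed.

Lemma cov_formZl (k : R) (c e : T -> R) :
  cov_form P s (fun x => k * c x) e = k * cov_form P s c e.
Proof.
rewrite /cov_form big_distrr/=; apply: eq_bigr => x _.
by rewrite big_distrr/=; apply: eq_bigr => y _; ring.
Qed.

Lemma cov_formC (c e : T -> R) : cov_form P s c e = cov_form P s e c.
Proof.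
rewrite /cov_form exchange_big/=; apply: eq_bigr => x _; apply: eq_bigr => y _.
by rewrite (covC P y x); ring.
Qed.

Let cov_shift (c : T -> R) (k : R) :
  cov_form P s (fun x => c x + k * a x) (fun x => c x + k * a x) =
  cov_form P s c c + 2 * k * cov_form P s a c + k ^+ 2.
Proof.
rewrite cov_formDl cov_formZl !(cov_formC _ (fun x => c x + k * a x)).
rewrite !cov_formDl !cov_formZl a1 (cov_formC c a); ring.
Qed.

Let cov_a (c : T -> R) : cov_form P s a c = \sum_(y <- s) c y * b y.
Proof.
rewrite /cov_form exchange_big/=; apply: eq_bigr => y _.
by rewrite /b big_distrr/=; apply: eq_bigr => x _; ring.
Qed.

Lemma linear_form_shift (c : T -> R) (k : R) w :
  linear_form s (fun x => c x + k * a x) w = linear_form s c w + k * N w.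
Proof.
rewrite /N /linear_form big_distrr/= -big_split/=; apply: eq_bigr => x _; ring.
Qed.

(** With [beta] the covariance of [N] and the form of [c], the left-hand variance is
    [cov_form P s c c + 2 * k * beta + k ^+ 2]. In the model, [t] contributes [(beta + k) ^+ 2] and
    the remainder [cov_form P s c c - beta ^+ 2], with the same sum. *)
Let cos_cov (c : T -> R) (k u : R) :
  \int[P]_w cos (\sum_(y <- s) c y * w y + k * N w + u) =
  \int[(gauss \x P)%E]_z cos (\sum_(y <- s) c y * X2 y z + k * z.1 + u).
Proof.
pose beta := \sum_(y <- s) c y * b y.
have XE z : \sum_(y <- s) c y * X2 y z + k * z.1 + u =
    linear_form s (fun x => c x + (- beta) * a x) z.2 + ((beta + k) * z.1 + u).
  have -> : \sum_(y <- s) c y * X2 y z = beta * z.1 + linear_form s c z.2 - beta * N z.2.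
    rewrite /beta /linear_form !mulr_suml -big_split/= -sumrB; apply: eq_bigr => y _.
    by rewrite /X2; ring.
  by rewrite linear_form_shift; ring.
have mcos : measurable_fun setT (fun z : R * field_space R T =>
    cos (\sum_(y <- s) c y * X2 y z + k * z.1 + u)).
  apply: measurable_cos_comp; apply: measurable_funD => //; apply: measurable_funD.
    by apply: measurable_sum => y; exact: measurable_funM.
  by apply: measurable_funM => //; exact: measurable_fst.
rewrite (bounded_prodE gauss P mcos (fun z => cos_le1N _)).
transitivity (\int[gauss]_t (cos ((beta + k) * t + u) *
    expR (- (cov_form P s (fun x => c x + (- beta) * a x) (fun x => c x + (- beta) * a x) / 2)))).
  have ic : gauss.-integrable setT (fun t => (cos ((beta + k) * t + u))%:E).
    apply: (@bounded_integrable _ _ _ gauss (fun t => cos ((beta + k) * t + u)) 1).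
      exact: measurable_cosM.
    by move=> t; exact: cos_le1N.
  rewrite (RintegralZr _ measurableT ic) gauss_cosD.
  transitivity (\int[P]_w cos (linear_form s (fun x => c x + k * a x) w + u)).
    by apply: eq_Rintegral => w _; rewrite linear_form_shift.
  rewrite (linear_form_cos Hg) -mulrA -expRD; congr (_ * expR _).
  by rewrite !cov_shift cov_a -/beta; field.
apply: eq_Rintegral => t _; rewrite -(linear_form_cos Hg).
by apply: eq_Rintegral => w _; rewrite XE.
Qed.

Variables (A : {set {ffun K -> bool}}) (h : R).

Let indic (chi : T -> bool) : R := excursion_indic A chi.
Let E1 (w : field_space R T) : R := indic (fun y => h <= w y).
Let E2 (z : R * field_space R T) : R := indic (fun y => h <= X2 y z).

(** A version of the conditional probability of the excursion event given [N = t]. Integrating out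
    the remainder defines it at every [t], so its monotonicity holds everywhere and not only almost
    everywhere. *)
Definition disintegrated_prob (t : R) : R := \int[P]_w E2 (t, w).

Let indic01 chi : `|indic chi| <= 1.
Proof. by rewrite ger0_norm; case/andP: (excursion_indic01 A chi). Qed.

Let mE1 : measurable_fun setT E1.
Proof. by apply: measurable_excursion_indic => y; exact: measurable_coord. Qed.

Let mE2 : measurable_fun setT E2.
Proof. exact: measurable_excursion_indic. Qed.

(** This transfers the joint law of the event and [N] to the model. After expansion over
    configurations, [cramer_wold] is applied with the weight [cos (k * N w + u)]; its hypothesis is
    an integral of a product of two cosines, which [split] reduces to [cos_cov] at [k] and at
    [- k]. *)
Let joint_cos (k u : R) :
  \int[P]_w (E1 w * cos (k * N w + u)) =
  \int[(gauss \x P)%E]_z (E2 z * cos (k * z.1 + u)).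
Proof.
have m1 : measurable_fun setT (fun z : R * field_space R T => z.1) by exact: measurable_fst.
have mkN : measurable_fun setT (fun w => k * N w + u).
  by apply: measurable_funD => //; exact: measurable_funM.
have mk1 : measurable_fun setT (fun z : R * field_space R T => k * z.1 + u).
  by apply: measurable_funD => //; exact: measurable_funM.
have split d (U : measurableType d) (Q : probability U R) (Y Z : U -> R) :
    measurable_fun setT Y -> measurable_fun setT Z ->
    \int[Q]_w (cos (Y w) * cos (Z w)) =
    (\int[Q]_w cos (Z w + Y w) + \int[Q]_w cos (Z w - Y w)) / 2.
  move=> mY mZ.
  have ic (V : U -> R) : measurable_fun setT V -> Q.-integrable setT (EFin \o (cos \o V)).
    move=> mV; apply: (@bounded_integrable _ _ _ Q (cos \o V) 1).
      exact: measurable_cos_comp.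
    by move=> w; exact: cos_le1N.
  have i1 := ic _ (measurable_funD mZ mY).
  have i2 := ic _ (measurable_funB mZ mY).
  rewrite -(RintegralD measurableT i1 i2).
  rewrite -(RintegralZr _ measurableT (integrableD measurableT i1 i2)).
  by apply: eq_Rintegral => w _; rewrite mulrC cosM_cos.
have CW := @cramer_wold R _ _ _ _ P (gauss \x P)%E T s (fun y w => w y) X2
  (fun w => cos (k * N w + u)) (fun z => cos (k * z.1 + u)) 1 (fset_uniq K)
  (@measurable_coord R T) mX2 (measurable_cos_comp mkN) (fun w => cos_le1N _)
  (measurable_cos_comp mk1) (fun w => cos_le1N _).
have {}CW := CW _ (fun=> h).
have prodE (bb : T -> bool) :
   \int[P]_w (cos (k * N w + u) * \prod_(i <- s) ((h <= w i)%R == bb i)%:R) =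
   \int[(gauss \x P)%E]_z (cos (k * z.1 + u) * \prod_(i <- s) ((h <= X2 i z)%R == bb i)%:R).
  apply: CW => c v.
  have mc1 : measurable_fun setT (fun w : field_space R T => \sum_(i <- s) c i * w i + v).
    by apply: measurable_funD => //; apply: measurable_linear_sum; exact: measurable_coord.
  have mc2 : measurable_fun setT (fun z => \sum_(i <- s) c i * X2 i z + v).
    by apply: measurable_funD => //; exact: measurable_linear_sum.
  rewrite !split//.
  congr ((_ + _) / _).
    transitivity (\int[P]_w cos (\sum_(y <- s) c y * w y + k * N w + (u + v))).
      by apply: eq_Rintegral => w _; congr cos; ring.
    rewrite cos_cov; apply: eq_Rintegral => z _; congr cos; ring.
  transitivity (\int[P]_w cos (\sum_(y <- s) c y * w y + (- k) * N w + (v - u))).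
    by apply: eq_Rintegral => w _; congr cos; ring.
  rewrite cos_cov; apply: eq_Rintegral => z _; congr cos; ring.
have expand d (U : measurableType d) (Q : probability U R) (Y : T -> U -> R)
     (V : U -> R) : (forall y, measurable_fun setT (Y y)) -> measurable_fun setT V ->
    \int[Q]_w (indic (fun y => h <= Y y w) * cos (V w)) =
    \sum_(bb <- enum A) \int[Q]_w (cos (V w) *
        \prod_(i <- s) ((h <= Y i w)%R == extend bb i)%:R).
  move=> mY mV.
  have iF (bb : {ffun K -> bool}) : Q.-integrable setT (fun w => (cos (V w) *
      \prod_(i <- s) ((h <= Y i w)%R == extend bb i)%:R)%:E).
    apply: (@bounded_integrable _ _ _ Q (fun w => cos (V w) *
        \prod_(i <- s) ((h <= Y i w)%R == extend bb i)%:R) 1).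
      apply: measurable_funM; first exact: measurable_cos_comp.
      by apply: measurable_prod => y _; exact: measurable_ge_indic.
    move=> w; rewrite normrM mulr_ile1// ?cos_le1N// normr_prod.
    by apply: prodr_ile1 => i _; rewrite normr_nat ler0n lern1 leq_b1.
  rewrite -(Rintegral_sum_seq (enum A) iF).2.
  apply: eq_Rintegral => w _; rewrite /indic excursion_indicE -big_enum/= mulrC.
  by rewrite big_distrr.
rewrite (expand _ _ P (fun y w => w y))//; last exact: measurable_coord.
rewrite (expand _ _ (gauss \x P)%E X2)//.
by apply: eq_bigr => bb _; exact: prodE.
Qed.

Let disint_prod (v : R -> R) (C : R) : measurable_fun setT v -> (forall t, `|v t| <= C) ->
  \int[(gauss \x P)%E]_z (E2 z * v z.1) =
  \int[gauss]_t (disintegrated_prob t * v t).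
Proof.
move=> mv vC.
have mEv : measurable_fun setT (fun z : R * field_space R T => E2 z * v z.1).
  by apply: measurable_funM => //; exact: (measurableT_comp mv measurable_fst).
have bEv z : `|E2 z * v z.1| <= C.
  by rewrite normrM (le_trans _ (vC z.1))// ler_piMl// indic01.
rewrite (bounded_prodE gauss P mEv bEv); apply: eq_Rintegral => t _.
rewrite /disintegrated_prob /=.
have iE : P.-integrable setT (fun w => (E2 (t, w))%:E).
  apply: (@bounded_integrable _ _ _ P (fun w => E2 (t, w)) 1).
    exact: (measurableT_comp mE2 (measurable_pair1 t)).
  by move=> w; exact: indic01.
by rewrite -(RintegralZr _ measurableT iE).
Qed.

Lemma disintegrated_prob01 t : 0 <= disintegrated_prob t <= 1.
Proof.
have iE : P.-integrable setT (fun w => (E2 (t, w))%:E).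
  apply: (@bounded_integrable _ _ _ P (fun w => E2 (t, w)) 1).
    exact: (measurableT_comp mE2 (measurable_pair1 t)).
  by move=> w; exact: indic01.
apply/andP; split.
  by apply: Rintegral_ge0 => w _; case/andP: (excursion_indic01 A (fun y => h <= X2 y (t, w))).
rewrite -[leRHS](Rintegral_probability_cst P).
apply: le_Rintegral => //; first exact: (finite_measure_integrable_cst P).
by move=> w _; case/andP: (excursion_indic01 A (fun y => h <= X2 y (t, w))).
Qed.

Lemma measurable_disintegrated_prob : measurable_fun setT disintegrated_prob.
Proof.
have mE : measurable_fun setT (fun z => (E2 z)%:E) by exact/measurable_EFinP.
have E0 z : (0 <= (E2 z)%:E)%E.
  by rewrite lee_fin; case/andP: (excursion_indic01 A (fun y => h <= X2 y z)).
have mF := @measurable_fun_fubini_tonelli_F _ _ _ _ _ P _ mE E0.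
exact: (measurableT_comp (fine_measurable measurableT) mF).
Qed.

Lemma nondecreasing_disintegrated_prob : increasing A ->
  (forall y, y \in K -> 0 <= b y) -> {homo disintegrated_prob : t t' / t <= t'}.
Proof.
move=> incA b0 t t' tt'.
have iE r : P.-integrable setT (fun w => (E2 (r, w))%:E).
  apply: (@bounded_integrable _ _ _ P (fun w => E2 (r, w)) 1).
    exact: (measurableT_comp mE2 (measurable_pair1 r)).
  by move=> w; exact: indic01.
apply: le_Rintegral; [by []|exact: iE|exact: iE|move=> w _].
apply: le_excursion_indic => // y yK.
by move=> /le_trans; apply; rewrite lerD2r ler_wpM2l// b0.
Qed.

Lemma disintegration_prob :
  \int[P]_w excursion_indic A (fun y => h <= w y) =
  \int[gauss]_t disintegrated_prob t.
Proof.
transitivity (\int[P]_w (E1 w * cos (0 * N w + 0))).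
  by apply: eq_Rintegral => w _; rewrite mul0r addr0 cos0 mulr1.
rewrite joint_cos.
transitivity (\int[(gauss \x P)%E]_z (E2 z * cst 1 z.1)).
  by apply: eq_Rintegral => z _; rewrite mul0r addr0 cos0.
rewrite (@disint_prod (cst 1) 1)//; last by move=> t; rewrite normr1.
by apply: eq_Rintegral => t _; rewrite mulr1.
Qed.

(** Fourier uniqueness in the variable [N], with the indicator of the event as weight; [joint_cos]
    is precisely its hypothesis. *)
Lemma disintegration_ge (c : R) :
  \int[P]_w (excursion_indic A (fun y => h <= w y) * (c <= N w)%R%:R) =
  \int[gauss]_t (disintegrated_prob t * (c <= t)%R%:R).
Proof.
have F := fourier_ge (P1 := P) (P2 := (gauss \x P)%E) mE1 mN (fun w => indic01 _)
  mE2 measurable_fst (fun w => indic01 _) joint_cos c.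
rewrite [LHS]F (@disint_prod (fun t => (c <= t)%R%:R) 1)//.
  exact: measurable_geT_indic.
by move=> t; rewrite normr_nat lern1 leq_b1.
Qed.

(** [N] is unbounded, hence not directly a test function. The phase [- (pi / 2)] in [joint_cos]
    gives the identity for [sin (k * N)], and differentiating it at [k = 0] produces [N]. *)
Lemma disintegration_mean :
  \int[P]_w (excursion_indic A (fun y => h <= w y) * N w) =
  \int[gauss]_t (disintegrated_prob t * t).
Proof.
have cosE (x : R) : cos (x + - (pi / 2)) = sin x.
  by rewrite cosB cos_pihalf sin_pihalf mulr0 add0r mulr1.
have sinE (k : R) : \int[P]_w (E1 w * sin (k * N w)) =
    \int[gauss]_t (disintegrated_prob t * sin (k * t)).
  transitivity (\int[P]_w (E1 w * cos (k * N w + - (pi / 2)))).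
    by apply: eq_Rintegral => w _; rewrite cosE.
  rewrite joint_cos (@disint_prod (fun t => cos (k * t + - (pi / 2))) 1).
  - by apply: eq_Rintegral => t _; rewrite cosE.
  - exact: measurable_cosM.
  - by move=> t; rewrite cos_le1N.
have sin_le1N (x : R) : `|sin x| <= 1 by rewrite ler_norml sin_geN1 sin_le1.
have dsin d (U : measurableType d) (Q : probability U R) (F Z : U -> R) :
    measurable_fun setT F -> (forall w, `|F w| <= 1) -> measurable_fun setT Z ->
    Q.-integrable setT (fun w => (`|Z w|)%:E) ->
    is_derive (0 : R) 1 (fun k : R => \int[Q]_w (F w * sin (k * Z w))) (\int[Q]_w (F w * Z w)).
  move=> mF F1 mZ iZ.
  have ->: \int[Q]_w (F w * Z w) = \int[Q]_w (F w * (Z w * cos (0 * Z w))).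
    by apply: eq_Rintegral => w _; rewrite mul0r cos0 mulr1.
  apply: (@is_derive_Rintegral _ _ _ Q (fun w => `|Z w|) (fun k w => F w * sin (k * Z w))
    (fun k w => F w * (Z w * cos (k * Z w))) 0 iZ).
  - move=> k; apply: (@bounded_integrable _ _ _ Q (fun w => F w * sin (k * Z w)) 1).
      apply: measurable_funM => //; apply: measurableT_comp.
        by apply: continuous_measurable_fun; exact: continuous_sin.
      exact: measurable_funM.
    by move=> w; rewrite normrM mulr_ile1.
  - move=> k w.
    have d1 : is_derive k (1 : R) (fun k : R => k * Z w) (Z w).
      have -> : (fun k : R => k * Z w) = (Z w) \*: (id : R -> R).
        by apply/funext => r; rewrite /GRing.scale/= mulrC.
      by apply: is_derive_eq; rewrite /GRing.scale/= mulr1.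
    have d2 := @is_derive1_comp _ sin _ k _ _ (is_derive_sin _) d1.
    have d3 := is_deriveZ (F w) d2.
    by apply: (is_derive_eq d3); rewrite /GRing.scale/=; ring.
  - move=> k w; rewrite !normrM -[leRHS]mul1r ler_pM// -[leRHS]mulr1 ler_pM//.
    exact: cos_le1N.
have iN : P.-integrable setT (fun w => `|N w|%:E).
  have [v _ H] := linear_form_centered_law Hg s a.
  have iv : gauss.-integrable setT (fun x => (v * x)%:E).
    exact: (integrableZl measurableT v (@integrable_gauss_id R)).
  have mid : measurable_fun setT (fun x : R => x) by [].
  exact: (integrable_norm (H _ mid iv).1).
have D1 := dsin _ _ P E1 N mE1 (fun w => indic01 _) mN iN.
have mid : measurable_fun setT (fun x : R => x) by [].
have f1 t : `|disintegrated_prob t| <= 1.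
  by rewrite ger0_norm; case/andP: (disintegrated_prob01 t).
have D2 := dsin _ _ gauss _ _ measurable_disintegrated_prob f1 mid
  (@norm_integrable_gauss_id R).
rewrite [LHS](_ : _ = \int[P]_w (E1 w * N w))//.
rewrite -(@derive_val _ _ _ _ _ _ _ D1) -(@derive_val _ _ _ _ _ _ _ D2).
by rewrite (_ : (fun k => \int[P]_w (E1 w * sin (k * N w))) =
    (fun k => \int[gauss]_t (disintegrated_prob t * sin (k * t))))//; apply/funext.
Qed.

End Disintegration.

(** * Markov property, escape probabilities and last exit for the killed walk *)

Section KilledWalkTheory.
Context {R : realType} {d : nat} {G : graph}.
Local Notation V := (vertex d G).
Local Notation Omega := (path_space d G).

Lemma countable_vertex : countable [set: V].
Proof. by rewrite /vertex; case: G => [|L HL] /=; exact: countableP. Qed.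

(** Allows events to be cut according to the state at a given time into a disjoint union indexed by
    [nat], as countable additivity requires. *)
Lemma vertex_code : exists code : option V -> nat, injective code.
Proof.
have /countable_injP[f finj] := countable_vertex.
exists (fun u => if u is Some y then (f y).+1 else 0%N) => -[y|] [z|]//= [e].
by congr Some; apply: finj; rewrite ?inE.
Qed.

Definition cylinder (n : nat) (w : nat -> option V) : set Omega :=
  [set X | forall k, (k <= n)%N -> X k = w k].

Lemma measurable_state (n : nat) (u : option V) : measurable [set X : Omega | X n = u].
Proof. by apply: sub_sigma_algebra; exists n, u. Qed.

Lemma measurable_state_set (n : nat) (S : set (option V)) :
  measurable [set X : Omega | S (X n)].
Proof.
have [code cinj] := vertex_code.
rewrite (_ : [set X | _] = \bigcup_i [set X : Omega | S (X n) /\ code (X n) = i]); last first.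
  by apply/seteqP; split => [X SX|X [i _ []//]]; exists (code (X n)).
apply: bigcupT_measurable => i.
have [[u [Su ui]]|nu] := pselect (exists u, S u /\ code u = i).
  rewrite (_ : [set X | _] = [set X : Omega | X n = u]); first exact: measurable_state.
  by apply/seteqP; split => [X [_ /=]|X /= ->//]; rewrite -ui => /cinj.
rewrite (_ : [set X | _] = set0); first exact: measurable0.
by apply/seteqP; split => // X [SX Xi]; apply: nu; exists (X n).
Qed.

Lemma measurable_cylinder n w : measurable (cylinder n w).
Proof.
rewrite (_ : cylinder n w = \bigcap_k [set X : Omega | (k <= n)%N -> X k = w k]); last first.
  by apply/seteqP; split => [X H k _ /=|X H k] //; [exact: H|exact: H].
apply: bigcapT_measurable => k; exact: (measurable_state_set k (fun u => (k <= n)%N -> u = w k)).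
Qed.

Lemma measurable_shift (n : nat) :
  measurable_fun setT (fun X : Omega => (fun k => X (n + k)%N) : Omega).
Proof.
apply: (@measurability _ _ Omega Omega setT
  (fun X : Omega => (fun k => X (n + k)%N) : Omega) (@path_events d G) erefl).
by move=> _ [_ [k [u ->]] <-]; rewrite setTI; exact: measurable_state.
Qed.

Let sum_coordinate (m1 m2 : {measure set Omega -> \bar R}) (B : set Omega) (k : nat) :
  measurable B ->
  (forall u, m1 (B `&` [set X | X k = u]) = m2 (B `&` [set X | X k = u])) ->
  m1 B = m2 B.
Proof.
move=> mB E; have [code cinj] := vertex_code.
pose F i := B `&` [set X : Omega | code (X k) = i].
have mF i : measurable (F i).
  by apply: measurableI => //; exact: (measurable_state_set k (fun u => code u = i)).
have BE : B = \bigcup_i F i.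
  by apply/seteqP; split => [X BX|X [i _ []//]]; exists (code (X k)).
have tF : trivIset setT F.
  by move=> i j _ _ [X [[_ <-] [_ <-]]].
have FE i : m1 (F i) = m2 (F i).
  have [[u ui]|nu] := pselect (exists u, code u = i).
    have -> : F i = B `&` [set X | X k = u]; last exact: E.
    rewrite /F; apply/seteqP; split => X [BX /= Xi]; split => //=.
      by apply: cinj; rewrite Xi ui.
    by rewrite Xi.
  rewrite (_ : F i = set0) ?measure0//.
  by apply/seteqP; split => // X [_ Xi]; apply: nu; exists (X k).
rewrite BE !measure_bigcup//=.
by apply: eq_eseriesr => i _.
Qed.

(** Backward induction on the number [j] of prescribed coordinates. With all [n.+1] prescribed, [B]
    contains the whole cylinder or misses it; releasing one coordinate sums over its countably many
    values, and at [j = 0] only [B] is left. *)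
Lemma cylinder_measure_eq (m1 m2 : {measure set Omega -> \bar R}) (n : nat) (B : set Omega) :
  (forall w, m1 (cylinder n w) = m2 (cylinder n w)) -> measurable B ->
  (forall X Y : Omega, (forall k, (k <= n)%N -> X k = Y k) -> B X -> B Y) ->
  m1 B = m2 B.
Proof.
move=> E mB detB.
pose Q j (v : nat -> option V) : set Omega := B `&` [set X | forall k, (k < j)%N -> X k = v k].
have mQ j v : measurable (Q j v).
  apply: measurableI => //; case: j => [|j].
    by rewrite (_ : [set X | _] = setT)//; apply/seteqP; split.
  exact: (measurable_cylinder j v).
suff H j : (j <= n.+1)%N -> forall v, m1 (Q j v) = m2 (Q j v).
  have := H 0%N isT (fun=> None).
  by rewrite /Q (_ : [set X | _] = setT) ?setIT//; apply/seteqP; split.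
move=> jn; rewrite -(subKn jn); move: (n.+1 - j)%N => {jn}.
elim => [|i IH] v.
  rewrite subn0.
  have [[X [BX Xv]]|nX] := pselect (exists X, Q n.+1 v X).
    rewrite (_ : Q n.+1 v = cylinder n v); first exact: E.
    apply/seteqP; split => [Y [_]//|Y Yv]; split => //.
    by apply: detB BX => k kn; rewrite Xv// Yv.
  by rewrite (_ : Q n.+1 v = set0) ?measure0//; apply/seteqP; split => // X QX; apply: nX; exists X.
(* Subtraction is truncated: once [i] reaches [n.+1], both stages are [0] and nothing is left to
   release. *)
case: (leqP n.+1 i) => [ni|ni].
  by move: (IH v); rewrite subnS; move: ni; rewrite -subn_eq0 => /eqP ->.
have iE : (n.+1 - i)%N = (n.+1 - i.+1).+1 by rewrite subnSK.
apply: (sum_coordinate (k := (n.+1 - i.+1)%N)) => // u.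
pose v' k := if k == (n.+1 - i.+1)%N then u else v k.
suff -> : Q (n.+1 - i.+1)%N v `&` [set X | X (n.+1 - i.+1)%N = u] = Q (n.+1 - i)%N v' by exact: IH.
rewrite iE; apply/seteqP; split => X.
  move=> [[BX Xv] /= Xu]; split => // k; rewrite ltnS leq_eqVlt /v'.
  by case: eqP => [->//|_ /= ki]; exact: Xv.
move=> [BX Xv]; split; last by rewrite /= Xv// /v' eqxx.
split => // k ki; rewrite Xv ?ltnS 1?ltnW// /v'.
by rewrite ltn_eqF.
Qed.

Context (theta : R) (theta01 : 0 < theta < 1).
Context (Pwalk : V -> probability Omega R).
Hypothesis law : forall x, killed_walk_law theta x (Pwalk x).

Lemma trans_ge0 (u v : option V) : 0 <= @trans R d G theta u v.
Proof.
have [t0 t1] := andP theta01.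
case: u v => [y|] [z|] //=; last exact: ltW.
apply: sumr_ge0 => i _; apply: mulr_ge0; first by rewrite addr_ge0.
by rewrite divr_ge0 ?ler0n// subr_ge0 ltW.
Qed.

Let path_weight N (w : nat -> option V) : R := \prod_(k < N) @trans R d G theta (w k) (w k.+1).

Let path_weight_ge0 N w : 0 <= path_weight N w.
Proof. by apply: prodr_ge0 => k _; exact: trans_ge0. Qed.

Lemma law_cylinder x N w :
  Pwalk x (cylinder N w) = ((w 0%N == Some x)%:R * path_weight N w)%:E.
Proof. exact: law. Qed.

(** Both sides are total masses of measures that agree on cylinders of length [n]: there the law is
    a product of transitions, which factors at time [n]. *)
Lemma markov_path x n N w :
  Pwalk x [set X | forall k, (k <= N)%N -> X (n + k)%N = w k] =
  (Pwalk x [set X | X n = w 0%N] * (path_weight N w)%:E)%E.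
Proof.
pose C := [set X : Omega | forall k, (k <= N)%N -> X (n + k)%N = w k].
have mC : measurable C.
  rewrite -[X in measurable X]setTI.
  exact: (measurable_shift n measurableT (measurable_cylinder N w)).
have mD := measurable_state n (w 0%N).
pose m1 : {measure set Omega -> \bar R} := mrestr (Pwalk x) mC.
pose m2 : {measure set Omega -> \bar R} :=
  mscale (NngNum (path_weight_ge0 N w)) (mrestr (Pwalk x) mD).
have m12 : m1 setT = m2 setT.
  apply: (@cylinder_measure_eq m1 m2 n) => // v.
  transitivity (Pwalk x (cylinder n v `&` C)); first by [].
  transitivity ((path_weight N w)%:E *
    Pwalk x (cylinder n v `&` [set X | X n = w 0%N]))%E; last by [].
  have [vw|vw] := eqVneq (v n) (w 0%N); last first.
    rewrite (_ : cylinder n v `&` C = set0); last first.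
      apply/seteqP; split => // X [Xv Xw]; move/eqP: vw; apply.
      by rewrite -Xv// -(Xw 0%N)// addn0.
    rewrite (_ : _ `&` _ = set0) ?measure0 ?mule0//.
    by apply/seteqP; split => // X [Xv /= Xw]; move/eqP: vw; apply; rewrite -Xv.
  (* The concatenation of the past [v] and the future [w]; they overlap at time [n], where
     [v n = w 0]. *)
  pose v' k := if (k <= n)%N then v k else w (k - n)%N.
  have -> : cylinder n v `&` C = cylinder (n + N) v'.
    apply/seteqP; split => X.
      move=> [Xv Xw] k kN; rewrite /v'; case: leqP => kn; first exact: Xv.
      have := Xw (k - n)%N; rewrite subnKC; last exact: ltnW.
      by apply; rewrite leq_subLR.
    move=> Xv; split => k kn.
      by rewrite Xv /v' ?kn// (leq_trans kn)// leq_addr.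
    rewrite Xv /v' ?leq_add2l//; case: leqP => [|nk]; last by rewrite addKn.
    by rewrite -{2}(addn0 n) leq_add2l leqn0 => /eqP ->; rewrite addn0.
  have -> : cylinder n v `&` [set X | X n = w 0%N] = cylinder n v.
    by apply/seteqP; split => [X []//|X Xv]; split => //=; rewrite Xv.
  rewrite !law_cylinder -EFinM; congr EFin.
  rewrite mulrCA; congr (_ * _); rewrite /path_weight big_split_ord/= mulrC.
  congr (_ * _); apply: eq_bigr => k _.
    have v'E j : v' (n + j)%N = w j.
      rewrite /v'; case: leqP => [|nj]; last by rewrite addKn.
      by rewrite -{2}(addn0 n) leq_add2l leqn0 => /eqP ->; rewrite addn0.
    by rewrite v'E -addnS v'E.
  by rewrite /v' ltn_ord (ltnW (ltn_ord k)).
transitivity (m1 setT); first by rewrite /m1/= /mrestr setTI.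
by rewrite m12 muleC /m2/= /mscale/= /mrestr setTI.
Qed.

(** As functions of the future event, both sides are measures, and [markov_path] shows that they
    agree on cylinders. This reaches events of finite horizon [N]; [markov_escape] removes the
    horizon. *)
Lemma markov_property x y n N (B : set Omega) : measurable B ->
  (forall X Y : Omega, (forall k, (k <= N)%N -> X k = Y k) -> B X -> B Y) ->
  Pwalk x ([set X | X n = Some y] `&` [set X | B (fun k => X (n + k)%N)]) =
  (Pwalk x [set X | X n = Some y] * Pwalk y B)%E.
Proof.
move=> mB detB.
have mD := measurable_state n (Some y).
pose r := fine (Pwalk x [set X | X n = Some y]).
have r0 : 0 <= r by rewrite fine_ge0.
have rE : Pwalk x [set X | X n = Some y] = r%:E by rewrite fineK// fin_num_measure.
pose sh (X : Omega) : Omega := fun k => X (n + k)%N.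
pose pm : {measure set Omega -> \bar R} := pushforward (mrestr (Pwalk x) mD) sh.
pose m1 := pm (measurable_shift n).
pose m2 : {measure set Omega -> \bar R} := mscale (NngNum r0) (Pwalk y).
transitivity (m1 B); first by rewrite setIC.
transitivity (m2 B); last by rewrite rE.
apply: (@cylinder_measure_eq m1 m2 N) => // w.
transitivity (Pwalk x ([set X | forall k, (k <= N)%N -> X (n + k)%N = w k] `&`
  [set X | X n = Some y])); first by [].
transitivity (r%:E * Pwalk y (cylinder N w))%E; last by [].
rewrite law_cylinder; have [wy|wy] := eqVneq (w 0%N) (Some y).
  rewrite mul1r -rE -wy -markov_path; congr (Pwalk x _).
  apply/seteqP; split => [X []//|X Xw]; split => //=.
  by rewrite -(Xw 0%N)// addn0.
rewrite mul0r mule0 (_ : _ `&` _ = set0) ?measure0//.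
apply/seteqP; split => // X [Xw /= Xn]; move/eqP: wy; apply.
by rewrite -(Xw 0%N)// addn0.
Qed.

Context (K : {fset V}).

Let avoid N : set Omega :=
  [set X | forall k, (1 <= k <= N)%N -> forall z, z \in K -> X k <> Some z].
Let escape : set Omega :=
  [set X | forall k, (1 <= k)%N -> forall z, z \in K -> X k <> Some z].

Let escapeE : escape = \bigcap_N avoid N.
Proof.
apply/seteqP; split => [X EX N _ k /andP[k1 _]|X AX k k1]; first exact: EX.
by apply: (AX k I); rewrite k1 leqnn.
Qed.

Let measurable_avoid N : measurable (avoid N).
Proof.
rewrite (_ : avoid N = \bigcap_k [set X : Omega | (1 <= k <= N)%N ->
    forall z, z \in K -> X k <> Some z]); last first.
  by apply/seteqP; split => [X H k _ /=|X H k]; [exact: H|exact: H].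
apply: bigcapT_measurable => k.
exact: (measurable_state_set k (fun u => (1 <= k <= N)%N -> forall z, z \in K -> u <> Some z)).
Qed.

Let measurable_escape : measurable escape.
Proof. by rewrite escapeE; exact: bigcapT_measurable. Qed.

Let nonincreasing_avoid : nonincreasing_seq avoid.
Proof.
move=> i j ij; apply/subsetPset => X AX k /andP[k1 ki]; apply: AX.
by rewrite k1 (leq_trans ki).
Qed.

Let kappaE x : (kappa_tr Pwalk K x)%:E = Pwalk x escape.
Proof.
have E : [set X | hitting_time R K X = +oo%E] = escape.
  apply/seteqP; split => X.
    move=> /= HX k k1 z zK Xk.
    have : (hitting_time R K X <= k%:R%:E)%E.
      by apply: ereal_inf_lbound; exists k => //; split => //; exists z.
    by rewrite HX.
  move=> EX /=; rewrite /hitting_time (_ : [set _ | _ in _] = set0) ?ereal_inf0//.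
  by apply/seteqP; split => // t [k [k1 [z zK Xk]] _]; exact: (EX k k1 z zK Xk).
by rewrite /kappa_tr fineK E// fin_num_measure.
Qed.

(** Escape depends on the whole future, so it is approached by the decreasing events [avoid N], and
    continuity from above is used on both sides. *)
Let markov_escape x y n :
  Pwalk x ([set X | X n = Some y] `&` [set X | escape (fun k => X (n + k)%N)]) =
  (Pwalk x [set X | X n = Some y] * (kappa_tr Pwalk K y)%:E)%E.
Proof.
rewrite kappaE.
have mD := measurable_state n (Some y).
have msh N : measurable [set X : Omega | avoid N (fun k => X (n + k)%N)].
  rewrite -[X in measurable X]setTI.
  exact: (measurable_shift n measurableT (measurable_avoid N)).
pose D N : set Omega := [set X : Omega | X n = Some y] `&` [set X : Omega | avoid N (fun k => X (n + k)%N)].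
have mDN N : measurable (D N) by exact: measurableI.
have DE : [set X | X n = Some y] `&` [set X | escape (fun k => X (n + k)%N)] = \bigcap_N D N.
  rewrite escapeE; apply/seteqP; split => X; first by move=> [Xy EX] N _; split => //; exact: EX.
  by move=> H; split => [|N _]; [case: (H 0%N I)|case: (H N I)].
have l1 : Pwalk x (D N) @[N --> \oo] --> Pwalk x (\bigcap_N D N).
  apply: nonincreasing_cvg_mu => //.
  - by rewrite -ge0_fin_numE// fin_num_measure.
  - exact: bigcapT_measurable.
  - move=> i j ij; apply/subsetPset => X [Xy AX]; split => //.
    by have /subsetPset := nonincreasing_avoid ij; exact.
have l2 : Pwalk y (avoid N) @[N --> \oo] --> Pwalk y escape.
  rewrite escapeE; apply: nonincreasing_cvg_mu => //.
  - by rewrite -ge0_fin_numE// fin_num_measure.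
  - exact: bigcapT_measurable.
rewrite DE -(cvg_lim (@ereal_hausdorff R) l1); apply: cvg_lim => //.
rewrite (_ : (fun N => Pwalk x (D N)) =
    (fun N => Pwalk x [set X | X n = Some y] * Pwalk y (avoid N))%E).
  by apply: cvgeZl => //; exact: fin_num_measure.
apply/funext => N.
apply: (@markov_property x y n N (avoid N) (measurable_avoid N)) => X Y XY AX k kN z zK.
have [_ kN2] := andP kN; rewrite -(XY k kN2); exact: (AX k kN z zK).
Qed.

Lemma green_ge0 x y : (0 <= green Pwalk x y)%E.
Proof. by apply: nneseries_ge0 => n _ _; exact: measure_ge0. Qed.

Let start_prob x : Pwalk x [set X | X 0%N = Some x] = 1%E.
Proof.
have -> : [set X | X 0%N = Some x] = cylinder 0 (fun=> Some x).
  apply/seteqP; split => X /=; last by move=> /(_ 0%N isT).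
  by move=> X0 [|k].
by rewrite law_cylinder eqxx /path_weight big_ord0 mulr1.
Qed.

Lemma green_diag_ge1 x : (1 <= green Pwalk x x)%E.
Proof.
rewrite -(start_prob x) /green.
have := @nneseries_lim_ge R (fun n => Pwalk x [set X | X n = Some x]) xpredT 0 1.
by rewrite big_nat1; apply.
Qed.

(** A walk killed at its first step never returns to [K]. The path that is at [x] and then stays in
    the cemetery has weight [theta] up to any time, the cemetery being absorbing. *)
Lemma kappa_ge x : theta <= kappa_tr Pwalk K x.
Proof.
have [t0 t1] := andP theta01.
rewrite -lee_fin kappaE.
pose w k : option V := if k is 0%N then Some x else None.
pose D N := cylinder N.+1 w.
have mD N : measurable (D N) by exact: measurable_cylinder.
have DE N : Pwalk x (D N) = theta%:E.
  rewrite law_cylinder eqxx mul1r /path_weight big_ord_recl/=.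
  by rewrite big1 ?mulr1.
have mcap : measurable (\bigcap_N D N) by exact: bigcapT_measurable.
have l1 : Pwalk x (D N) @[N --> \oo] --> Pwalk x (\bigcap_N D N).
  apply: nonincreasing_cvg_mu => //.
  - by rewrite -ge0_fin_numE// fin_num_measure.
  - move=> i j ij; apply/subsetPset => X XD k ki; apply: XD.
    by rewrite (leq_trans ki).
have <- : Pwalk x (\bigcap_N D N) = theta%:E.
  rewrite -(cvg_lim (@ereal_hausdorff R) l1); apply: cvg_lim => //.
  by under eq_fun do rewrite DE; exact: cvg_cst.
apply: le_measure; rewrite ?inE//.
move=> X XD [//|k] _ z zK.
by rewrite (XD k I k.+1).
Qed.

(* The walk visits [K] finitely often (Borel-Cantelli), so the events that the last
   visit is at [y] form a partition up to a null set. *)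
Lemma last_exit x : x \in K ->
  (forall y, y \in K -> green Pwalk x y \is a fin_num) ->
  \sum_(y <- enum_fset K) fine (green Pwalk x y) * kappa_tr Pwalk K y = 1.
Proof.
move=> xK gfin.
pose L (y : V) n : set Omega :=
  [set X : Omega | X n = Some y] `&` [set X : Omega | escape (fun k => X (n + k)%N)].
have mL y n : measurable (L y n).
  apply: measurableI; first exact: measurable_state.
  rewrite -[X in measurable X]setTI.
  exact: (measurable_shift n measurableT measurable_escape).
(* A visit to [K] followed by an escape is the last one, so its time is determined by the path, and
   then so is its position: the events [L y n] are disjoint. *)
have L_last y z n m X : L y n X -> L z m X -> z \in K -> y \in K -> n = m.
  have lt y1 z1 n1 m1 : L y1 n1 X -> L z1 m1 X -> z1 \in K -> (n1 < m1)%N -> False.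
    move=> [_ /= E] [Xm _] zK nm; apply: (E (m1 - n1)%N _ z1 zK).
      by rewrite subn_gt0.
    by rewrite subnKC// ltnW.
  move=> Ly Lz zK yK; case: (ltngtP n m) => // nm.
    by have := lt _ _ _ _ Ly Lz zK nm.
  by have := lt _ _ _ _ Lz Ly yK nm.
pose U y := \bigcup_n L y n.
have mU y : measurable (U y) by exact: bigcupT_measurable.
have UE y : y \in K -> Pwalk x (U y) = (fine (green Pwalk x y) * kappa_tr Pwalk K y)%:E.
  move=> yK; rewrite /U measure_bigcup//; last first.
    by move=> n m _ _ [X [Ln Lm]]; exact: (L_last _ _ _ _ _ Ln Lm yK yK).
  rewrite EFinM fineK ?gfin// muleC /green.
  rewrite -nneseriesZl; last by move=> n _; exact: measure_ge0.
  transitivity (\sum_(0 <= n <oo) Pwalk x (L y n))%E.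
    by apply: eq_eseriesl => n; rewrite in_setT.
  by apply: eq_eseriesr => n _; rewrite markov_escape muleC.
have tU : trivIset [set` enum_fset K] U.
  move=> y z /= yK zK [X [[n _ Ln] [m _ Lm]]].
  have nm := L_last _ _ _ _ _ Ln Lm zK yK.
  case: Ln => Xn _; case: Lm => Xm _; rewrite -nm in Xm.
  by have := Xn; rewrite /= Xm => -[].
pose I y : set Omega := lim_sup_set (fun n => [set X : Omega | X n = Some y]).
have mI y : measurable (I y).
  apply: bigcapT_measurable => n; apply: bigcup_measurable => k _.
  exact: measurable_state.
have I0 y : y \in K -> Pwalk x (I y) = 0%E.
  move=> yK; apply: lim_sup_set_cvg0; first by move=> k; exact: measurable_state.
  by have := gfin y yK; rewrite (ge0_fin_numE (green_ge0 x y)).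
pose Z := ~` [set X : Omega | X 0%N = Some x] `|` \big[setU/set0]_(y <- enum_fset K) I y.
have mbig (s : seq V) : measurable (\big[setU/set0]_(y <- s) I y).
  by apply: bigsetU_measurable => y _; exact: mI.
have Z0 : Pwalk x Z = 0%E.
  rewrite /Z measureU0//.
  - have := probability_setC (Pwalk x) (measurable_state 0 (Some x)).
    by rewrite start_prob subee.
  - by apply: measurableC; exact: measurable_state.
  - have : {subset enum_fset K <= K} by [].
    elim: (enum_fset K) => [|y s IH] sK; first by rewrite big_nil measure0.
    rewrite big_cons measureU0//; first by apply: I0; apply: sK; rewrite mem_head.
    by apply: IH => z zs; apply: sK; rewrite in_cons zs orbT.
have mUU : measurable (\bigcup_(y in [set` enum_fset K]) U y).
  by apply: fin_bigcup_measurable => // y _; exact: mU.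
have cover : \bigcup_(y in [set` enum_fset K]) U y `|` Z = setT.
  apply/seteqP; split => // X _.
  have [X0|X0] := pselect (X 0%N = Some x); last by right; left.
  have [[y [yK IyX]]|nI] := pselect (exists y, y \in K /\ I y X).
    right; right; rewrite -bigcup_seq; by exists y.
  left.
  have [N HN] : exists N, forall y, y \in enum_fset K -> forall j, (N <= j)%N -> X j <> Some y.
    have : {subset enum_fset K <= K} by [].
    elim: (enum_fset K) => [|y s IH] sK; first by exists 0%N.
    have [N HN] := IH (fun z zs => sK z (mem_behead (s := y :: s) zs)).
    have [M HM] : exists M, forall j, (M <= j)%N -> X j <> Some y.
      apply: contrapT => nM; apply: nI; exists y; split; first by apply: sK; rewrite mem_head.
      move=> n _; apply: contrapT => nn; apply: nM; exists n => j nj Xj.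
      by apply: nn; exists j.
    exists (maxn N M) => z; rewrite in_cons => /orP[/eqP ->|zs] j; rewrite geq_max => /andP[Nj Mj].
      exact: HM.
    exact: HN.
  pose visit n := `[< exists2 y, y \in K & X n = Some y >].
  (* Since [x] lies in [K], time [0] is a visit; visit times are also bounded by [N], and their
     maximum is the last exit. *)
  have ex_visit : exists n, visit n by exists 0%N; apply/asboolP; exists x.
  have ub n : visit n -> (n <= N)%N.
    move=> /asboolP[y yK Xn]; rewrite leqNgt; apply/negP => Nn.
    by apply: (HN y yK n) => //; exact: ltnW.
  case: (ex_maxnP ex_visit ub) => n /asboolP[y yK Xn] nmax.
  exists y => //; exists n => //; split => // k k1 z zK Xk.
  have : (n + k <= n)%N by apply: nmax; apply/asboolP; exists z.
  by rewrite leqNgt -{1}(addn0 n) ltn_add2l k1.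
have : Pwalk x (\bigcup_(y in [set` enum_fset K]) U y) = 1%E.
  have mZ : measurable Z.
    by apply: measurableU => //; apply: measurableC; exact: measurable_state.
  by have := measureU0 mUU mZ Z0; rewrite cover => <-; exact: probability_setT.
rewrite measure_fin_bigcup//.
rewrite -fsbig_seq ?fset_uniq//.
rewrite (eq_big_seq (fun y => (fine (green Pwalk x y) * kappa_tr Pwalk K y)%:E)); last first.
  by move=> y yK; exact: UE.
by rewrite sumEFin => -[].
Qed.

End KilledWalkTheory.

(** * The influence inequality at one vertex *)

Section ExcursionInfluence.
Context {R : realType} {T : choiceType}.
Local Notation gauss := (normal_prob (0 : R) 1).
Context (P : probability (field_space R T) R) (g : T -> T -> \bar R).
Hypothesis Hg : centered_gaussian_field P g.
Context (K : {fset T}) (A : {set {ffun K -> bool}}).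
Local Notation s := (enum_fset K).
Local Notation exc h := (fun w : field_space R T => excursion_indic A (fun y => h <= w y) : R).

Lemma fine_probability (F : field_space R T -> bool) :
  measurable [set w | F w] -> fine (P [set w | F w]) = \int[P]_w (F w)%:R.
Proof.
move=> mF; rewrite -[in LHS](setIT [set w | F w]) -integral_indic//.
congr fine; apply: eq_integral => w _; rewrite indicE; congr ((nat_of_bool _)%:R%:E).
by apply/idP/idP; rewrite inE.
Qed.

Lemma measurable_exc (h : R) : measurable_fun setT (exc h).
Proof. by apply: measurable_excursion_indic => y; exact: measurable_coord. Qed.

Lemma exc_norm_le1 (h : R) w : `|exc h w| <= 1.
Proof. by have /andP[e0 e1] := @excursion_indic01 R T K A (fun y => h <= w y); rewrite ger0_norm. Qed.

Lemma measurable_excursion_event (h : R) : measurable (excursion_event A h).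
Proof.
have -> : excursion_event A h = exc h @^-1` [set 1].
  apply/seteqP; split => w; rewrite /excursion_event /excursion_indic /=.
    by move=> ->.
  by case: (_ \in A) => //= /eqP; rewrite eq_sym oner_eq0.
by rewrite -[X in measurable X]setTI; exact: (measurable_exc h measurableT (measurable_set1 1)).
Qed.

Lemma excursion_probE (h : R) : excursion_prob P A h = \int[P]_w exc h w.
Proof.
exact: (fine_probability (F := fun w => [ffun z : K => h <= w (val z)] \in A)
  (measurable_excursion_event h)).
Qed.

Lemma measurable_ge_coord x (c : R) : measurable [set w : field_space R T | c <= w x].
Proof.
have := measurable_coord (R := R) x measurableT (measurable_itv `[c, +oo[).
congr (measurable _); apply/seteqP; split => w.
  by move=> [_ /=]; rewrite in_itv/= andbT.
by move=> /= cw; split => //=; rewrite in_itv/= cw.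
Qed.

Lemma integrable_exc_coord (h : R) x : P.-integrable setT (fun w => (exc h w * w x)%:E).
Proof.
have bnd : [bounded exc h w | w in setT].
  exists 1; split; first exact: num_real.
  by move=> N N1 w _; exact: le_trans (exc_norm_le1 h w) (ltW N1).
exact: (integrableMr measurableT (measurable_exc h) bnd (integrable_coord Hg x)).
Qed.

(** Leaves only integrals involving the event and the upper half-line, the lower one being obtained
    by complement; these are the integrals that the disintegration transfers to the normal law. *)
Lemma influenceE (h : R) x :
  influence P A h x =
  (\int[P]_w (exc h w * (h <= w x)%R%:R)) / (\int[P]_w (h <= w x)%R%:R) -
  (\int[P]_w exc h w - \int[P]_w (exc h w * (h <= w x)%R%:R)) /
    (1 - \int[P]_w (h <= w x)%R%:R).
Proof.
have mE := measurable_excursion_event h.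
have mF := measurable_ge_coord x h.
have FC : [set w : field_space R T | w x < h] = ~` [set w : field_space R T | h <= w x].
  by apply/seteqP; split => w /=; rewrite ltNge => /negP.
have mF' : measurable [set w : field_space R T | w x < h].
  by rewrite FC; exact: measurableC.
pose S w : bool := [ffun z : K => h <= w (val z)] \in A.
have e1 : fine (P [set w | h <= w x]) = \int[P]_w (h <= w x)%R%:R by exact: fine_probability.
have e2 : fine (P [set w | w x < h]) = 1 - \int[P]_w (h <= w x)%R%:R.
  rewrite FC probability_setC// -e1.
  by rewrite fineB// fin_num_measure.
have e3 : fine (P (excursion_event A h `&` [set w | h <= w x])) =
    \int[P]_w (exc h w * (h <= w x)%R%:R).
  have -> : excursion_event A h `&` [set w | h <= w x] = [set w | S w && (h <= w x)%R].
    by apply/seteqP; split => w /=; [move=> [? ?]; apply/andP|move=> /andP].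
  rewrite fine_probability; last first.
    rewrite (_ : [set w | _] = excursion_event A h `&` [set w | h <= w x]); first exact: measurableI.
    by apply/seteqP; split => w /=; [move=> /andP|move=> [? ?]; apply/andP].
  by apply: eq_Rintegral => w _; rewrite -mulnb natrM.
have e4 : fine (P (excursion_event A h `&` [set w | w x < h])) =
    \int[P]_w exc h w - \int[P]_w (exc h w * (h <= w x)%R%:R).
  rewrite -e3 -excursion_probE /excursion_prob -fineB ?fin_num_measure//; last exact: measurableI.
  congr fine; rewrite FC -setDE measureD//.
  by rewrite -ge0_fin_numE// fin_num_measure.
by rewrite /influence /cond_prob e1 e2 e3 e4.
Qed.

(** The field is disintegrated along [phi x / sigma]. The one-dimensional bound enters as a
    hypothesis with [c] given, so that a single constant serves every graph, set and vertex. *)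
Lemma gaussian_influence_bound (M c : R) :
  (forall (f : R -> R) (a : R), measurable_fun setT f ->
    {homo f : x y / x <= y} -> (forall x, 0 <= f x <= 1) -> - M < a < M ->
    0 <= \int[gauss]_x (x * f x) /\
    c * ((\int[gauss]_x (f x * (a <= x)%R%:R)) / (\int[gauss]_x (a <= x)%R%:R)
     - (\int[gauss]_x (f x * (x < a)%R%:R)) / (\int[gauss]_x (x < a)%R%:R))
    <= \int[gauss]_x (x * f x)) ->
  increasing A -> forall (h : R) x, x \in K -> - M < h < M ->
  1 <= cov P x x -> (forall y, y \in K -> 0 <= cov P x y) ->
  0 <= \int[P]_w (exc h w * w x) /\
  c * influence P A h x <= \int[P]_w (exc h w * w x).
Proof.
move=> bound incA h x xK hM cov1 cov0.
pose sigma := Num.sqrt (cov P x x).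
have s1 : 1 <= sigma by rewrite -sqrtr1 ler_wsqrtr.
have s0 : 0 < sigma := lt_le_trans ltr01 s1.
have sE : sigma ^+ 2 = cov P x x by rewrite sqr_sqrtr// (le_trans ler01).
pose a y : R := (y == x)%:R / sigma.
have pick (F : T -> R) : \sum_(y <- s) a y * F y = F x / sigma.
  rewrite (bigD1_seq x)//= /a eqxx mul1r mulrC big1 ?addr0// => y yx.
  by rewrite (negbTE yx) mul0r mul0r.
have a1 : cov_form P s a a = 1.
  transitivity (\sum_(y <- s) a y * (cov P y x / sigma)).
    apply: eq_bigr => y _; rewrite -(pick (fun z => cov P y z)) big_distrr/=.
    by apply: eq_bigr => z _; rewrite mulrA.
  rewrite (pick (fun y => cov P y x / sigma)) -sE; field.
  by rewrite gt_eqF.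
have NE w : linear_form s a w = w x / sigma by exact: (pick (fun y => w y)).
have bE y : \sum_(z <- s) a z * cov P z y = cov P x y / sigma by exact: pick.
pose f := disintegrated_prob P a A h.
have f01 := disintegrated_prob01 P a A h.
have mf := measurable_disintegrated_prob P a A h.
have homf : {homo f : t t' / t <= t'}.
  apply: nondecreasing_disintegrated_prob => // y yK; rewrite bE.
  by apply: divr_ge0; [exact: cov0|exact: ltW].
have mean := disintegration_mean Hg a1 A h.
have mean' : \int[P]_w (exc h w * w x) = sigma * \int[gauss]_t (t * f t).
  rewrite (_ : \int[gauss]_t (t * f t) = \int[gauss]_t (f t * t)); last first.
    by apply: eq_Rintegral => t _; rewrite mulrC.
  rewrite -mean -RintegralZl//; last first.
    have := integrableZl measurableT sigma^-1 (integrable_exc_coord h x).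
    by apply: eq_integrable => // w _; rewrite /= NE -EFinM; congr EFin; ring.
  by apply: eq_Rintegral => w _; rewrite NE; field; rewrite gt_eqF.
have geE w : (h / sigma <= linear_form s a w) = (h <= w x).
  by rewrite NE ler_pM2r ?invr_gt0.
have ge1 := disintegration_ge Hg a1 A h (h / sigma).
(* With the full set of configurations the excursion event is sure, and the disintegration reduces
   to the law of the linear form itself. *)
have ge2 := disintegration_ge Hg a1 [set: {ffun K -> bool}]%SET h (h / sigma).
have tot := disintegration_prob Hg a1 A h.
have exT chi : excursion_indic (R := R) [set: {ffun K -> bool}]%SET chi = 1.
  by rewrite /excursion_indic inE.
have ge1' : \int[P]_w (exc h w * (h <= w x)%R%:R) =
    \int[gauss]_t (f t * (h / sigma <= t)%R%:R).
  by rewrite -ge1; apply: eq_Rintegral => w _; rewrite geE.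
have ge2' : \int[P]_w (h <= w x)%R%:R = \int[gauss]_t (h / sigma <= t)%R%:R :> R.
  transitivity (\int[P]_w (excursion_indic [set: {ffun K -> bool}]%SET (fun y => h <= w y)
      * (h / sigma <= linear_form s a w)%R%:R)).
    by apply: eq_Rintegral => w _; rewrite exT mul1r geE.
  rewrite ge2; apply: eq_Rintegral => t _.
  rewrite -[RHS]mul1r; congr (_ * _); rewrite -[RHS](Rintegral_probability_cst P).
  by apply: eq_Rintegral => w _; exact: exT.
have mge : measurable_fun setT (fun t : R => (h / sigma <= t)%R%:R : R).
  exact: measurable_geT_indic.
have ige : gauss.-integrable setT (fun t => ((h / sigma <= t)%R%:R)%:E).
  apply: (@bounded_integrable _ _ _ gauss _ 1 mge) => t.
  by rewrite normr_nat lern1 leq_b1.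
have fle1 t : `|f t| <= 1 by rewrite ger0_norm; case/andP: (f01 t).
have ifge : gauss.-integrable setT (fun t => (f t * (h / sigma <= t)%R%:R)%:E).
  apply: (@bounded_integrable _ _ _ gauss (fun t => f t * (h / sigma <= t)%R%:R) 1).
    exact: measurable_funM.
  by move=> t; rewrite normrM mulr_ile1// normr_nat lern1 leq_b1.
have ltE t : (t < h / sigma)%R%:R = 1 - (h / sigma <= t)%R%:R :> R.
  by rewrite ltNge; case: (_ <= _)%R; rewrite ?subrr ?subr0.
have lt1 : \int[gauss]_t (t < h / sigma)%R%:R = 1 - \int[P]_w (h <= w x)%R%:R :> R.
  rewrite ge2' -[X in X - _](Rintegral_probability_cst gauss).
  rewrite -RintegralB//; last exact: (finite_measure_integrable_cst gauss).
  by apply: eq_Rintegral => t _; rewrite ltE.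
have lt2 : \int[gauss]_t (f t * (t < h / sigma)%R%:R) =
    \int[P]_w exc h w - \int[P]_w (exc h w * (h <= w x)%R%:R).
  rewrite ge1' tot -RintegralB//; last exact: (@bounded_integrable _ _ _ gauss f 1).
  by apply: eq_Rintegral => t _; rewrite ltE -/(f t); ring.
have hsM : - M < h / sigma < M.
  have /andP[h1 h2] := hM; have hle : `|h / sigma| <= `|h|.
    by rewrite normrM normfV (gtr0_norm s0) ler_pdivrMr// ler_peMr.
  have : `|h| < M by rewrite ltr_norml hM.
  by move=> /(le_lt_trans hle); rewrite ltr_norml.
have := bound f (h / sigma) mf homf f01 hsM.
rewrite -ge1' -ge2' lt1 lt2 -influenceE => -[J0 B].
rewrite mean'; split; first by rewrite mulr_ge0// ltW.
by apply: (le_trans B); rewrite ler_peMl.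
Qed.

End ExcursionInfluence.

(** * The derivative of the excursion probability in the level *)

Section ExcursionDerivative.
Context {R : realType} {T : choiceType}.
Local Notation gauss := (normal_prob (0 : R) 1).
Context (P : probability (field_space R T) R) (g : T -> T -> \bar R).
Hypothesis Hg : centered_gaussian_field P g.
Context (K : {fset T}) (A : {set {ffun K -> bool}}).
Local Notation s := (enum_fset K).

(** Differentiability comes from the smoothness of the normal density along one direction, for any
    [A]. The weights are abstract: the walk will enter only through [equil] and the positive total
    mass. *)
Lemma is_derive_excursion_prob (kap : T -> R) (h : R) :
  (forall y, y \in K -> \sum_(x <- s) kap x * cov P x y = 1) ->
  0 < \sum_(x <- s) kap x ->
  is_derive h 1 (excursion_prob P A)
    (- \int[P]_w (excursion_indic A (fun y => h <= w y) * linear_form s kap w)).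
Proof.
move=> equil cap0.
pose cap := \sum_(x <- s) kap x.
(* By [equil] the form with weights [kap] has variance [cap]. Dividing by [sigma] gives the unit
   variance required by the disintegration, and its covariance with each coordinate in [K] becomes
   [sigma^-1]. *)
pose sigma := Num.sqrt cap.
have s0 : 0 < sigma by rewrite sqrtr_gt0.
have sE : sigma ^+ 2 = cap by rewrite sqr_sqrtr// ltW.
pose a y : R := kap y / sigma.
have bE y : y \in K -> \sum_(x <- s) a x * cov P x y = sigma^-1.
  move=> yK; rewrite -[RHS]mul1r -(equil y yK) big_distrl/=.
  by apply: eq_bigr => x _; rewrite /a mulrAC.
have a1 : cov_form P s a a = 1.
  rewrite /cov_form exchange_big/=.
  transitivity (\sum_(y <- s) a y * sigma^-1).
    rewrite big_seq [RHS]big_seq; apply: eq_bigr => y yK.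
    rewrite -(bE y yK) big_distrr/=; apply: eq_bigr => x _; ring.
  rewrite -big_distrl/= /a -big_distrl/= -/cap -sE; field.
  by rewrite gt_eqF.
have NE w : linear_form s a w = linear_form s kap w / sigma.
  by rewrite /linear_form big_distrl/=; apply: eq_bigr => x _; rewrite /a mulrAC.
pose f := disintegrated_prob P a A h.
have mf : measurable_fun setT f by exact: measurable_disintegrated_prob.
have fexp (x : R) : `|f x| <= 1 * expR `|x|.
  apply: bounded_le_exp => y; have /andP[f0 f1] := disintegrated_prob01 P a A h y.
  by rewrite ger0_norm.
(* On [K] the coefficient of [t] is the constant [sigma^-1], so raising the level from [h] to [k]
   has the same effect as lowering [t] by [sigma * (k - h)]. This puts the level into a translation
   of the fixed function [f]. *)
have probE k : excursion_prob P A k = \int[gauss]_t f (t + (- sigma * (k - h))).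
  rewrite excursion_probE (disintegration_prob Hg a1 A k).
  apply: eq_Rintegral => t _; apply: eq_Rintegral => w _.
  apply: eq_excursion_indic => y yK /=; rewrite bE//.
  have -> : sigma^-1 * (t + - sigma * (k - h)) = sigma^-1 * t - (k - h).
    by field; rewrite gt_eqF.
  by apply/idP/idP => H; lra.
have D := is_derive_gauss_shift mf fexp.
have d1 : is_derive h 1 (fun k : R => - sigma * (k - h)) (- sigma).
  have -> : (fun k : R => - sigma * (k - h)) = (- sigma) \*: (id - cst h : R -> R).
    by apply/funext.
  by apply: is_derive_eq; rewrite /GRing.scale/=; ring.
have D' : is_derive (- sigma * (h - h)) 1 (fun u => \int[gauss]_x f (x + u))
    (\int[gauss]_x (x * f x)) by rewrite subrr mulr0.
have DD := @is_derive1_comp R _ _ h _ _ D' d1.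
rewrite (_ : excursion_prob P A =
    (fun u => \int[gauss]_x f (x + u)) \o (fun k => - sigma * (k - h))); last first.
  by apply/funext => k; rewrite probE.
apply: (is_derive_eq DD).
have -> : \int[gauss]_x (x * f x) =
    \int[P]_w (excursion_indic A (fun y => h <= w y) * linear_form s a w).
  rewrite (disintegration_mean Hg a1 A h).
  by apply: eq_Rintegral => t _; rewrite mulrC.
rewrite mulrN; congr (- _).
have iN : P.-integrable setT
    (fun w => (excursion_indic A (fun y => h <= w y) * linear_form s a w)%:E).
  have [v _ H] := linear_form_centered_law Hg s a.
  have iv : gauss.-integrable setT (fun x => (v * x)%:E).
    exact: (integrableZl measurableT v (@integrable_gauss_id R)).
  have mid : measurable_fun setT (fun x : R => x) by [].
  have bnd : [bounded (excursion_indic A (fun y => h <= w y) : R) | w in [set: field_space R T]].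
    exists 1; split; first exact: num_real.
    by move=> N N1 w _; exact: le_trans (exc_norm_le1 A h w) (ltW N1).
  exact: (integrableMr measurableT (measurable_exc A h) bnd (H _ mid iv).1).
rewrite -(RintegralZr _ measurableT iN); apply: eq_Rintegral => w _.
by rewrite NE mulrA divfK// gt_eqF.
Qed.

End ExcursionDerivative.

Theorem proposition3p2 (R : realType) (d : nat) (hd : (3 <= d)%N)
  (theta : R) (htheta : 0 < theta < 1) (M : R) (hM : 0 < M) :
  exists2 c1 : R, 0 < c1 &
  forall (G : graph)
    (Pwalk : vertex d G -> probability (path_space d G) R)
    (_ : forall x, killed_walk_law theta x (Pwalk x))
    (P : probability (field_space R (vertex d G)) R)
    (_ : centered_gaussian_field P (green Pwalk))
    (K : {fset vertex d G}) (_ : K != fset0)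
    (A : {set {ffun K -> bool}}) (_ : increasing A)
    (h : R) (_ : - M < h < M),
  (forall x, x \in K ->
    ((c1 * influence P A h x)%:E <=
     'E_P[fun phi => (\1_(excursion_event A h) phi
                      * (kappa_tr Pwalk K x * phi x))%R])%E) /\
  derivable (excursion_prob P A) h 1 /\
  c1 * \sum_(y : K) influence P A h (val y) <= - derive1 (excursion_prob P A) h.
Proof.
have [c0 c0_gt0 bound] := gauss_monotone_bound M.
have [t0 t1] := andP htheta.
(* [c0] comes from the one-dimensional inequality and is chosen before the graph; [theta] bounds
   every [kappa_tr] from below. *)
exists (theta * c0); first exact: mulr_gt0.
move=> G Pwalk law P Hg K K0 A incA h hM'.
have gE x y : green Pwalk x y = (cov P x y)%:E := covE Hg x y.
have cov0 x y : 0 <= cov P x y by rewrite -lee_fin -gE green_ge0.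
have cov1 x : 1 <= cov P x x by rewrite -lee_fin -gE (green_diag_ge1 law).
have kap x : theta <= kappa_tr Pwalk K x := kappa_ge htheta law K x.
have kap0 x : 0 < kappa_tr Pwalk K x := lt_le_trans t0 (kap x).
have exc_indicE w : \1_(excursion_event A h) w = excursion_indic A (fun y => h <= w y) :> R.
  rewrite indicE /excursion_indic; congr ((nat_of_bool _)%:R).
  by apply/idP/idP; rewrite inE.
have iex x := integrable_exc_coord Hg A h x.
have main x : x \in K -> theta * c0 * influence P A h x <=
    kappa_tr Pwalk K x * \int[P]_w (excursion_indic A (fun y => h <= w y) * w x).
  move=> xK; have [J0 J1] := gaussian_influence_bound Hg bound incA xK hM' (cov1 x) (fun y _ => cov0 x y).
  (* The bound [J1] is multiplied by [theta], then [theta] is raised to [kappa_tr] on the larger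
     side, which is allowed by [J0]; the sign of the influence does not enter. *)
  by rewrite -mulrA (le_trans (ler_wpM2l (ltW t0) J1))// ler_wpM2r.
split.
  move=> x xK; rewrite unlock.
  have -> : (\int[P]_w (\1_(excursion_event A h) w * (kappa_tr Pwalk K x * w x))%:E =
      (kappa_tr Pwalk K x * \int[P]_w (excursion_indic A (fun y => h <= w y) * w x))%:E)%E.
    rewrite -(RintegralZl _ measurableT (iex x)) /Rintegral fineK; last first.
      apply: integrable_fin_num => //.
      exact: (integrableZl measurableT (kappa_tr Pwalk K x) (iex x)).
    by apply: eq_integral => w _; rewrite exc_indicE; congr EFin; ring.
  by rewrite lee_fin main.
(* Last exit for the walk started at [y], read through the symmetry of the covariance. The
   finiteness of the Green function that it requires comes from [gE]. *)
have equil y : y \in K -> \sum_(x <- enum_fset K) kappa_tr Pwalk K x * cov P x y = 1.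
  move=> yK; have gfin z : z \in K -> green Pwalk y z \is a fin_num by rewrite gE.
  rewrite -(last_exit htheta law yK gfin); apply: eq_bigr => x _.
  by rewrite gE/= mulrC covC.
have cap0 : 0 < \sum_(x <- enum_fset K) kappa_tr Pwalk K x.
  have [x xK] := fset0Pn _ K0.
  rewrite (bigD1_seq x)//= ltr_pwDl// sumr_ge0// => y _; exact: ltW.
have D := is_derive_excursion_prob Hg A h equil cap0.
split; first exact: ex_derive.
rewrite derive1E (@derive_val _ _ _ _ _ _ _ D) opprK.
have iK x : P.-integrable setT
    (fun w => (kappa_tr Pwalk K x * (excursion_indic A (fun y => h <= w y) * w x))%:E).
  exact: (integrableZl measurableT (kappa_tr Pwalk K x) (iex x)).
have -> : \int[P]_w (excursion_indic A (fun y => h <= w y) *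
      linear_form (enum_fset K) (kappa_tr Pwalk K) w) =
    \sum_(x <- enum_fset K) kappa_tr Pwalk K x *
      \int[P]_w (excursion_indic A (fun y => h <= w y) * w x).
  under [RHS]eq_bigr => x _ do rewrite -(RintegralZl _ measurableT (iex x)).
  rewrite -(Rintegral_sum_seq (enum_fset K) iK).2; apply: eq_Rintegral => w _.
  rewrite /linear_form big_distrr/=; apply: eq_bigr => x _; ring.
rewrite -(big_seq_fsetE +%R K predT (fun y => influence P A h y))/=.
rewrite big_distrr/= big_seq [leRHS]big_seq; apply: ler_sum => x xK.
exact: main.
Qed.
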